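(* Let $V$ be a finite-dimensional real vector space of vector fields on $\mathbb{R}^n$ with associated quasi-Lie family $\mathcal{V}$, and let $\Phi:G\times\mathbb{R}^n\to\mathbb{R}^n$ be a Lie group action with $G$ connected. Let $W_\Phi$ be the Lie algebra of fundamental vector fields of $\Phi$. Then $\Phi$ is a structure preserving group of $\mathcal{V}$ if and only if the pair $(W_\Phi,V)$ is a quasi-Lie scheme.
   Context: All objects are smooth. A $t$-dependent vector field on $\mathbb{R}^n$ is a map $X:\mathbb{R}\times\mathbb{R}^n\to T\mathbb{R}^n$ with $X(t,x)\in T_x\mathbb{R}^n$, i.e. a family $\{X_t\}_{t\in\mathbb{R}}$ of vector fields. The quasi-Lie family $\mathcal{V}$ associated with a finite-dimensional vector space $V$ of vector fields is the $C^\infty(\mathbb{R})$-module of all $t$-dependent vector fields $X$ with $X_t\in V$ for every $t$. A quasi-Lie scheme is a pair $(W,V)$ (denoted $S(W,V)$) of finite-dimensional vector spaces of vector fields on $\mathbb{R}^n$ with $[W,W]\subset W\subset V$ and $[W,V]\subset V$. A curve $g:t\in\mathbb{R}\mapsto g_t\in G$ acts on $t$-dependent vector fields by $$(g_{\bigstar}X)_t=\frac{\partial g_t}{\partial t}\circ g_t^{-1}+g_{t*}X_t,$$ where $g_t$ also denotes the diffeomorphism $x\mapsto\Phi(g_t,x)$; equivalently, $g_\bigstar X$ is the $t$-dependent vector field with $\bar g_*(\partial_t+X)=\partial_t+g_\bigstar X$ for the diffeomorphism $\bar g(t,x)=(t,\Phi(g_t,x))$. The action $\Phi$ is a structure preserving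 group of $\mathcal{V}$ if $g_{\bigstar}X\in\mathcal{V}$ for every curve $g$ in $G$ and every $X\in\mathcal{V}$. *)

(* Defs.v *)
From HB Require Import structures.
From mathcomp Require Import all_boot all_order all_algebra.
From mathcomp Require Import all_classical all_reals all_analysis.
Import GRing.Theory Num.Theory numFieldNormedType.Exports.

Set Implicit Arguments.
Unset Strict Implicit.
Unset Printing Implicit Defensive.

Local Open Scope classical_set_scope.
Local Open Scope ring_scope.

(* A group carrying a topology; no compatibility is imposed at this level, it
   follows from the smoothness of the operations in [lie_group]. *)
#[short(type="topologicalGroupCarrierType")]
HB.structure Definition TopologicalGroupCarrier :=
  {G of Group G & Topological G}.

Section Smoothness.
Context {R : realType} {E F : normedModType R}.

(* [U] is meant to be open and [E] finite-dimensional: the derivative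
   x |-> 'd f x is then C^k iff all its evaluations x |-> 'd f x v are. *)
Fixpoint class_C (k : nat) (U : set E) (f : E -> F) : Prop :=
  match k with
  | 0%N => forall x, U x -> {for x, continuous f}
  | k'.+1 => (forall x, U x -> differentiable f x) /\
             (forall v : E, class_C k' U (fun x => 'd f x v))
  end.

Definition smooth_on (U : set E) (f : E -> F) : Prop :=
  forall k, class_C k U f.

End Smoothness.

(* The data of a chart of M modelled on E; [fwd] is relevant only on [cdom] and
   [bwd] only on [ccod]. *)
Record chart (M E : Type) := Chart {
  cdom : set M;
  ccod : set E;
  fwd : M -> E;
  bwd : E -> M
}.

Definition is_chart (M : topologicalType) (R : realType) (E : normedModType R)
    (c : chart M E) : Prop :=
  [/\ open (cdom c) /\ open (ccod c),
      (forall p, cdom c p -> ccod c (fwd c p) /\ bwd c (fwd c p) = p),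
      (forall y, ccod c y -> cdom c (bwd c y) /\ fwd c (bwd c y) = y),
      {within cdom c, continuous (fwd c)} &
      {within ccod c, continuous (bwd c)}].

(* Atlases need not be maximal: smoothness of a map does not depend on the
   choice of an atlas of the smooth structure. *)
Definition smooth_atlas (M : topologicalType) (R : realType)
    (E : normedModType R) (A : set (chart M E)) : Prop :=
  [/\ (forall c, A c -> is_chart c),
      (forall p, exists2 c, A c & cdom c p) &
      (forall c c', A c -> A c' ->
         smooth_on (ccod c `&` bwd c @^-1` cdom c') (fwd c' \o bwd c))].

Definition smooth_map (M N : topologicalType) (R : realType)
    (E F : normedModType R) (A : set (chart M E)) (B : set (chart N F))
    (f : M -> N) : Prop :=
  continuous f /\
  (forall c c', A c -> B c' ->
     smooth_on (ccod c `&` bwd c @^-1` (f @^-1` cdom c'))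
               (fwd c' \o f \o bwd c)).

Definition std_atlas (E : Type) : set (chart E E) :=
  [set Chart [set: E] [set: E] id id].
Arguments std_atlas E : clear implicits.

Definition prod_chart (M N E F : Type) (c : chart M E) (c' : chart N F) :
    chart (M * N) (E * F) :=
  Chart (cdom c `*` cdom c') (ccod c `*` ccod c')
        (fun p => (fwd c p.1, fwd c' p.2)) (fun y => (bwd c y.1, bwd c' y.2)).

Definition prod_atlas (M N E F : Type) (A : set (chart M E))
    (B : set (chart N F)) : set (chart (M * N) (E * F)) :=
  [set cc | exists c c', [/\ A c, B c' & cc = prod_chart c c']].

Definition lie_group (G : topologicalGroupCarrierType) (R : realType) (d : nat)
    (A : set (chart G 'rV[R]_d)) : Prop :=
  [/\ hausdorff_space G /\ @second_countable G,
      smooth_atlas A,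
      smooth_map (prod_atlas A A) A (fun p : G * G => (p.1 * p.2)%g) &
      smooth_map A A (fun g : G => g^-1%g)].

Section QuasiLie.
Context {R : realType} {n : nat}.

(* Vector fields on R^n, identified with their components. *)
Notation field := ('rV[R]_n -> 'rV[R]_n).

Definition lie_bracket (X Y : field) : field :=
  fun x => 'd Y x (X x) - 'd X x (Y x).

Definition findim_space_of_fields (V : set field) : Prop :=
  exists (m : nat) (e : 'I_m -> field),
    (forall i, smooth_on setT (e i)) /\
    V = [set X | exists a : 'I_m -> R, X = fun x => \sum_(i < m) a i *: e i x].

Definition brackets_in (W V U : set field) : Prop :=
  forall X Y, W X -> V Y -> U (lie_bracket X Y).

Definition quasi_lie_scheme (W V : set field) : Prop :=
  [/\ findim_space_of_fields W /\ findim_space_of_fields V,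
      brackets_in W W W, W `<=` V & brackets_in W V V].

Definition quasi_lie_family (V : set field) : set (R -> field) :=
  [set X | smooth_on setT (fun p : R * 'rV[R]_n => X p.1 p.2) /\
           forall t, V (X t)].

Context {G : topologicalGroupCarrierType} {d : nat}.
Variable A : set (chart G 'rV[R]_d).

Definition lie_group_action (Phi : G -> field) : Prop :=
  [/\ smooth_map (prod_atlas A (std_atlas 'rV[R]_n)) (std_atlas 'rV[R]_n)
        (fun p : G * 'rV[R]_n => Phi p.1 p.2),
      (forall x, Phi 1%g x = x) &
      (forall g h x, Phi (g * h)%g x = Phi g (Phi h x))].

Definition smooth_curve (g : R -> G) : Prop := smooth_map (std_atlas R) A g.

(* The differential at the identity of the orbit map g |-> Phi g x, applied to
   the tangent vector whose components in the chart c are xi. *)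
Definition fundamental_field (Phi : G -> field) (c : chart G 'rV[R]_d)
    (xi : 'rV[R]_d) : field :=
  fun x => 'd (fun y => Phi (bwd c y) x) (fwd c 1%g) xi.

Definition fundamental_fields (Phi : G -> field) : set field :=
  [set X | exists c xi,
     [/\ A c, cdom c 1%g & X = fundamental_field Phi c xi]].

(* The inverse of the diffeomorphism Phi (g t) is Phi (g t)^-1. *)
Definition star_action (Phi : G -> field) (g : R -> G) (X : R -> field) :
    R -> field :=
  fun t x =>
    let y := Phi (g t)^-1%g x in
    derive1 (fun s => Phi (g s) y) t + 'd (Phi (g t)) y (X t y).

Definition structure_preserving (V : set field) (Phi : G -> field) : Prop :=
  forall g X, smooth_curve g -> quasi_lie_family V X ->
    quasi_lie_family V (star_action Phi g X).

End QuasiLie.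

(* Main.v *)
From HB Require Import structures.
Require Import Defs.
From mathcomp Require Import all_boot all_order all_algebra.
From mathcomp Require Import all_classical all_reals all_analysis.
From mathcomp Require Import ring lra.
Import Order.TTheory GRing.Theory Num.Theory numFieldNormedType.Exports.

(* The fundamental vector fields are the velocities at 0 of the flows
   [Phi (h s)] along smooth curves [h] with [h 0 = 1], and
   [(g * X)_t] is the velocity at [t] of the flow along [s |-> g_s g_t^-1] plus
   the push-forward of [X_t] by [g_t]. Hence structure preservation amounts to:
   [W] is contained in [V] and [V] is stable under all push-forwards.

   The derivative at [s0] of [s |-> (h_s^-1)_* Y] is the bracket of the velocity
   of [h] with [Y] when [h_s0 = 1] (symmetry of second derivatives). A
   finite-dimensional space of fields is determined by finitely many point
   evaluations, so it is closed under pointwise differentiation in a parameter;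
   therefore stability under push-forwards gives stability under brackets with
   [W], for [V] as well as for [W] itself, which is stable by conjugation.

   Conversely, if [[W, V]] is contained in [V], then along a curve [h] from 1 the
   fields [(h_s^-1)_* u_i], for [u_i] spanning [V], satisfy a linear differential
   equation [Z_i' = sum_j M_ij(s) Z_j]; a functional vanishing on [V] then
   vanishes on the [Z_i] by uniqueness of solutions, so they stay in [V]. This
   covers a neighbourhood of 1, which generates the connected group [G]. *)

Set Implicit Arguments.
Unset Strict Implicit.
Unset Printing Implicit Defensive.

Local Open Scope classical_set_scope.
Local Open Scope ring_scope.

(** * Calculus of maps of class C^k *)

Section differential_complements.
Context {R : realType}.
Implicit Types V W : normedModType R.

(** The first-order expansion of [f] at [x] only involves the germ, hence is also one of [g];
    uniqueness of the differential does the rest. It serves for maps that agree only on an open set,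
    such as expressions in charts. *)
Lemma near_eq_is_diff V W (f g df : V -> W) (x : V) :
  {near x, f =1 g} -> is_diff x f df -> is_diff x g df.
Proof.
move=> fg [difff <-].
have fg0 : \forall h \near 0, f (h + x) = g (h + x).
  by have := fg; rewrite {1}[X in X -> _](near_shift 0 x) subr0.
have gE : g \o shift x = cst (g x) + 'd f x +o_0 id.
  apply/eqaddoP => e e0.
  have /eqaddoP /(_ e e0) := diff_locally difff.
  apply: filterS2 fg0 => h fgh.
  rewrite -![(_ - _ : _ -> _) h]/(_ - _) -![(_ + _ : _ -> _) h]/(_ + _) /=.
  by rewrite /cst -(nbhs_singleton fg) fgh.
have dgE : 'd g x = 'd f x :> (V -> W).
  by apply: diff_unique => //; exact: diff_continuous.
apply: DiffDef => //.
by apply/diff_locallyP; rewrite dgE; split => //; exact: diff_continuous.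
Qed.

Lemma scaler_bilinear V :
  bilinear_for (GRing.Scale.Law.clone _ _ *:%R _)
    (GRing.Scale.Law.clone _ _ *:%R _) (@GRing.scale R V).
Proof.
split=> [u'|u] a x y /=; first by rewrite scalerDl scalerA.
by rewrite scalerDr !scalerA mulrC.
Qed.

Lemma is_diff_scale V W (a da : V -> R) (f df : V -> W) x :
  is_diff x a da -> is_diff x f df ->
  is_diff x (fun y => a y *: f y) (fun v => a x *: df v + da v *: f x).
Proof.
move=> dax dfx.
(* Scaling is packed as a bilinear map, so that the product rule becomes the chain rule through the
   pair [(a, f)]. *)
pose B := bilinear_isBilinear.Build _ _ _ _ _ _ _ (scaler_bilinear W).
pose b : {bilinear R -> W -> W} := HB.pack (@GRing.scale R W) B.
have bc : continuous (fun p : R * W => b p.1 p.2).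
  by move=> p; exact: scale_continuous.
have db : is_diff (a x, f x) (fun p => b p.1 p.2)
    (fun q => b (a x) q.2 + b q.1 (f x)).
  by apply: DiffDef; [exact: differentiable_bilin|rewrite diff_bilin].
by have := @is_diff_comp _ _ _ _ _ _ _ _ x (is_diff_pair dax dfx) db.
Qed.

Lemma is_diff_lin V W (l : {linear V -> W}) (x : V) :
  continuous l -> is_diff x l l.
Proof.
by move=> cl; apply: DiffDef; [exact: linear_differentiable|rewrite diff_lin].
Qed.

End differential_complements.

Section class_C_theory.
Context {R : realType}.
Implicit Types E F H : normedModType R.

Lemma class_C_subset E F k (U U' : set E) (f : E -> F) :
  U' `<=` U -> class_C k U f -> class_C k U' f.
Proof.
move=> UU'; elim: k f => [|k IH] f /= => [fC x /UU'|[fd fC]]; first exact: fC.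
by split=> [x /UU'|v]; [exact: fd|exact: IH].
Qed.

(** Openness of [U] turns equality of values into equality of germs, which passes to the
    derivatives. *)
Lemma eq_class_C E F k (U : set E) (f g : E -> F) : open U ->
  (forall x, U x -> f x = g x) -> class_C k U f -> class_C k U g.
Proof.
move=> oU; elim: k f g => [|k IH] f g fg /=.
  move=> fC x Ux; have := fC x Ux.
  rewrite /prop_for /continuous_at (fg _ Ux) => /(cvg_trans _); apply.
  apply: near_eq_cvg.
  by apply: filterS (open_nbhs_nbhs (conj oU Ux)).
move=> [fd fC].
have dg x : U x -> is_diff x g ('d f x).
  move=> Ux; apply: near_eq_is_diff (differentiableP (fd _ Ux)).
  by apply: filterS (open_nbhs_nbhs (conj oU Ux)).
split=> [x /dg []//|v]; apply: IH (fC v) => x /dg dgx.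
by rewrite [in RHS]diff_val.
Qed.

(** Continuity and differentiability are taken in the whole space, so [class_C] is a condition at
    each point separately and the sets [B] may be arbitrary. *)
Lemma class_C_local E F k (U : set E) (f : E -> F) :
  (forall x, U x -> exists2 B, B x & class_C k B f) -> class_C k U f.
Proof.
elim: k f => [|k IH] f /= fO; first by move=> x /fO[B Bx]; apply.
split=> [x /fO[B Bx [+ _]]|v]; first by apply.
by apply: IH => x /fO[B Bx [_ fC]]; exists B.
Qed.

Lemma class_CW E F k (U : set E) (f : E -> F) :
  class_C k.+1 U f -> class_C k U f.
Proof.
elim: k f => [|k IH] f [fd fC].
  by move=> x /fd; exact: differentiable_continuous.
by split=> // v; exact: IH.
Qed.

Lemma class_C_continuous E F k (U : set E) (f : E -> F) x :
  class_C k U f -> U x -> {for x, continuous f}.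
Proof. by elim: k => [|k IH] fC; [exact: fC|apply: IH; exact: class_CW]. Qed.

Lemma class_C_cst E F k (U : set E) (a : F) : class_C k U (cst a).
Proof.
elim: k a => [|k IH] a /=; first by move=> x _; exact: cvg_cst.
split=> [x _|v]; first exact: differentiable_cst.
under eq_fun do rewrite diff_cst.
exact: IH.
Qed.

Lemma class_C_linear E F k (U : set E) (l : {linear E -> F}) :
  continuous l -> class_C k U l.
Proof.
move=> cl; case: k => [|k] /=; first by move=> x _; exact: cl.
split=> [x _|v]; first exact: linear_differentiable.
under eq_fun do rewrite diff_lin//.
exact: class_C_cst.
Qed.

(** Allows an explicit formula for the differential, so that the closure properties below follow by
    induction on [k] from the usual rules of calculus. *)
Lemma class_CS E F k (U : set E) (f : E -> F) (df : E -> E -> F) : open U ->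
  (forall x, U x -> is_diff x f (df x)) ->
  (forall v, class_C k U (df ^~ v)) -> class_C k.+1 U f.
Proof.
move=> oU dfE dfC; split=> [x /dfE[]//|v].
by apply: eq_class_C (dfC v) => // x /dfE dfx; rewrite diff_val.
Qed.

Lemma class_C_diff E F k (U : set E) (f : E -> F) x :
  class_C k.+1 U f -> U x -> is_diff x f ('d f x).
Proof. by move=> [fd _] /fd; exact: differentiableP. Qed.

Lemma class_C_comp_linear E F H k (U : set E) (l : {linear F -> H}) f :
  open U -> continuous l -> class_C k U f -> class_C k U (l \o f).
Proof.
move=> oU cl; elim: k f => [|k IH] f fC.
  by move=> x /fC cf; apply: continuous_comp => //; exact: cl.
apply: (@class_CS _ _ _ _ _ (fun x => l \o 'd f x)) => // [x Ux|v].
  exact: is_diff_comp (class_C_diff fC Ux) (is_diff_lin _ cl).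
exact: (IH (fun x => 'd f x v) (fC.2 v)).
Qed.

Lemma class_CD E F k (U : set E) (f g : E -> F) : open U ->
  class_C k U f -> class_C k U g -> class_C k U (fun x => f x + g x).
Proof.
move=> oU; elim: k f g => [|k IH] f g fC gC.
  by move=> x Ux; apply: cvgD; [exact: fC|exact: gC].
apply: (@class_CS _ _ _ _ _ (fun x v => 'd f x v + 'd g x v)) => // [x Ux|v].
  exact: is_diffD (class_C_diff fC Ux) (class_C_diff gC Ux).
exact: IH (fC.2 v) (gC.2 v).
Qed.

Lemma class_C_sum E F k (U : set E) (I : Type) (r : seq I) (f : I -> E -> F) :
  open U -> (forall i, class_C k U (f i)) ->
  class_C k U (fun x => \sum_(i <- r) f i x).
Proof.
move=> oU fC; elim: r => [|i r IH].
  by under eq_fun do rewrite big_nil; exact: class_C_cst.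
by under eq_fun do rewrite big_cons; exact: class_CD.
Qed.

Lemma class_C_scale E F k (U : set E) (a : E -> R) (f : E -> F) : open U ->
  class_C k U a -> class_C k U f -> class_C k U (fun x => a x *: f x).
Proof.
move=> oU; elim: k a f => [|k IH] a f aC fC.
  by move=> x Ux; apply: cvgZ; [exact: aC|exact: fC].
apply: (@class_CS _ _ _ _ _ (fun x v => a x *: 'd f x v + 'd a x v *: f x)).
- by [].
- move=> x Ux.
  exact: is_diff_scale (class_C_diff aC Ux) (class_C_diff fC Ux).
- move=> v; apply: class_CD => //; apply: IH; do ?[exact: class_CW].
    exact: fC.2.
  exact: aC.2.
Qed.

Lemma class_C_pair E F H k (U : set E) (f : E -> F) (g : E -> H) : open U ->
  class_C k U f -> class_C k U g -> class_C k U (fun x => (f x, g x)).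
Proof.
move=> oU; elim: k f g => [|k IH] f g fC gC.
  by move=> x Ux; apply: cvg_pair; [exact: fC|exact: gC].
apply: (@class_CS _ _ _ _ _ (fun x v => ('d f x v, 'd g x v))) => // [x Ux|v].
  exact: is_diff_pair (class_C_diff fC Ux) (class_C_diff gC Ux).
exact: IH (fC.2 v) (gC.2 v).
Qed.

(** The coordinates are continuous linear forms: a differential evaluated at a moving vector then
    becomes a finite sum of its values at fixed vectors, weighted by scalar functions. *)
Definition finite_dimensional E := exists (I : finType) (e : I -> E)
    (l : I -> {linear E -> R}),
  (forall i, continuous (l i)) /\ forall v, v = \sum_i l i v *: e i.

Lemma class_C_comp E F H k (U : set E) (U' : set F) (f : E -> F) (g : F -> H) :
  finite_dimensional F -> open U -> (forall x, U x -> U' (f x)) ->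
  class_C k U f -> class_C k U' g -> class_C k U (g \o f).
Proof.
move=> [I [e [l [cl le]]]] oU UU'; elim: k g => [|k IH] g fC gC.
  by move=> x Ux; apply: continuous_comp; [exact: fC|exact/gC/UU'].
apply: (@class_CS _ _ _ _ _ (fun x => 'd g (f x) \o 'd f x)) => // [x Ux|v].
  exact: is_diff_comp (class_C_diff fC Ux) (class_C_diff gC (UU' _ Ux)).
(* The induction hypothesis only concerns ['d g] at fixed vectors, so the moving vector ['d f x v]
   is expanded in coordinates. *)
have -> : (fun x => ('d g (f x) \o 'd f x) v) =
    (fun x => \sum_i (l i \o (fun x => 'd f x v)) x *:
       ((fun y => 'd g y (e i)) \o f) x).
  apply/funext => x /=; rewrite [in LHS](le ('d f x v)) linear_sum.
  by apply: eq_bigr => i _; rewrite linearZ.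
apply: class_C_sum => // i; apply: class_C_scale => //.
  by apply: class_C_comp_linear => //; exact: fC.2.
by apply: IH; [exact: class_CW|exact: gC.2].
Qed.

Lemma class_C_diff_apply E F H k (U : set E) (a v : E -> F) (g : F -> H) :
  finite_dimensional F -> open U ->
  class_C k U a -> class_C k U v -> class_C k.+1 setT g ->
  class_C k U (fun x => 'd g (a x) (v x)).
Proof.
move=> fdF oU aC vC gC; have [I [e [l [cl le]]]] := fdF.
have -> : (fun x => 'd g (a x) (v x)) =
    (fun x => \sum_i (l i \o v) x *: ((fun y => 'd g y (e i)) \o a) x).
  apply/funext => x /=; rewrite [in LHS](le (v x)) linear_sum.
  by apply: eq_bigr => i _; rewrite linearZ.
apply: class_C_sum => // i; apply: class_C_scale => //.
  exact: class_C_comp_linear.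
by apply: (@class_C_comp _ _ _ _ _ setT) => //; exact: gC.2.
Qed.

End class_C_theory.

(** * Finite-dimensional normed spaces *)

Section finite_dimensional_spaces.
Context {R : realType}.
Implicit Types E F : normedModType R.

Lemma finite_dimensional_real : finite_dimensional (R : normedModType R).
Proof.
exists unit, (fun=> 1), (fun=> idfun); split=> [_|v]; first by move=> x.
by rewrite big_const card_unit /= addr0; exact/esym/mulr1.
Qed.

Lemma finite_dimensional_rV n : finite_dimensional 'rV[R]_n.
Proof.
pose l (i : 'I_n) (M : 'rV[R]_n) : R := M 0 i.
have ll i : linear (l i) by move=> a x y; rewrite /l !mxE.
pose lM i := GRing.isLinear.Build _ _ _ _ _ (ll i).
pose lL i : {linear 'rV[R]_n -> R} := HB.pack (l i) (lM i).
exists 'I_n, (fun i => delta_mx 0 i), lL; split=> [i|v].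
  exact: coord_continuous.
exact: row_sum_delta.
Qed.

Lemma finite_dimensional_prod E F :
  finite_dimensional E -> finite_dimensional F ->
  finite_dimensional (E * F)%type.
Proof.
move=> [I [e [l [cl le]]]] [J [f [m [cm mf]]]].
pose ef (k : I + J) : E * F :=
  match k with inl i => (e i, 0) | inr j => (0, f j) end.
pose lm (k : I + J) : {linear (E * F)%type -> R} :=
  match k with inl i => l i \o fst | inr j => m j \o snd end.
exists (I + J)%type, ef, lm; split=> [[i|j] p|[x y]].
- by apply: continuous_comp; [exact: cvg_fst|exact: cl].
- by apply: continuous_comp; [exact: cvg_snd|exact: cm].
- apply: injective_projections; rewrite [in RHS]raddf_sum big_sumType /=.
    by rewrite [X in _ + X]big1 => [|i _]; rewrite ?scaler0// addr0; exact: le.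
  by rewrite big1 => [|i _]; rewrite ?scaler0// add0r; exact: mf.
Qed.

End finite_dimensional_spaces.

(** * Symmetry of second derivatives *)

Section schwarz.
Context {R : realType}.
Implicit Types E F : normedModType R.

Lemma is_diff_is_derive E F (f df : E -> F) x v :
  is_diff x f df -> is_derive x v f (df v).
Proof.
move=> [fd <-]; apply: DeriveDef; first exact: diff_derivable.
exact: deriveE.
Qed.

Lemma is_derive_line E F (f : E -> F) (x u : E) (s : R) :
  differentiable f (x + s *: u) ->
  is_derive s 1 (fun s => f (x + s *: u)) ('d f (x + s *: u) u).
Proof.
move=> /differentiableP fd.
have lineD : is_diff s (fun s => x + s *: u) (fun s => s *: u).
  have := is_diffD (is_diff_cst x s) (is_diff_scalel s u).
  by rewrite add0r.
have := is_diff_is_derive (1 : R) (is_diff_comp lineD fd).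
by rewrite /= scale1r.
Qed.

Lemma diff_comp_linear E F (H : normedModType R) (l : {linear F -> H})
  (f : E -> F) x v :
  continuous l -> differentiable f x ->
  'd (l \o f) x v = l ('d f x v).
Proof.
by move=> cl fd; rewrite diff_comp ?diff_lin//; exact: linear_differentiable.
Qed.

(** The mean value theorem is applied twice: along [u] to the increment of [f] in direction
    [h *: v], then along [v] to ['d f] evaluated at [u]. *)
Lemma second_difference_mean_value E (f : E -> R) (x u v : E) (h : R) :
  class_C 2 setT f -> 0 < h ->
  exists a b, [/\ 0 <= a <= h, 0 <= b <= h &
    f (x + h *: u + h *: v) - f (x + h *: u) - f (x + h *: v) + f x =
    'd (fun y => 'd f y u) (x + a *: u + b *: v) v * h * h].
Proof.
move=> [fd fC] h0.
have dline (g : E -> R) y w (s : R) : (forall z, differentiable g z) ->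
    is_derive s 1 (fun s => g (y + s *: w)) ('d g (y + s *: w) w).
  by move=> gd; exact: is_derive_line.
have lineC (g : E -> R) y w (s : R) : (forall z, differentiable g z) ->
    {for s, continuous (fun s : R => g (y + s *: w))}.
  move=> gd; apply: differentiable_continuous; apply/derivable1_diffP.
  by have [] := dline g y w s gd.
have fd' z : differentiable f z by exact: fd.
have [| |a /[!in_itv]/andP[a0 ah] Ea] := @MVT R
  (fun s => f (x + h *: v + s *: u) - f (x + s *: u))
  (fun s => 'd f (x + h *: v + s *: u) u - 'd f (x + s *: u) u) 0 h h0.
  by move=> s _; apply: is_deriveB; exact: dline.
  by apply: continuous_subspaceT => s; apply: cvgB; exact: lineC.
have [| |b /[!in_itv]/andP[b0 bh] Eb] := @MVT R
  (fun s => 'd f (x + a *: u + s *: v) u)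
  (fun s => 'd (fun y => 'd f y u) (x + a *: u + s *: v) v) 0 h h0.
- by move=> s _; apply: (dline (fun y => 'd f y u)) => z; exact: (fC u).1.
- apply: continuous_subspaceT => s; apply: (lineC (fun y => 'd f y u)) => z.
  exact: (fC u).1.
exists a, b; split; [by rewrite !ltW|by rewrite !ltW|].
move: Ea Eb; rewrite !scale0r !addr0 subr0 => Ea Eb.
rewrite -[in RHS]Eb -[x + a *: u + h *: v]addrAC -Ea.
by rewrite [x + h *: v + h *: u]addrAC opprB addrA; ring.
Qed.

(** Both mixed derivatives, taken at suitable points near [x], equal the second difference divided
    by [h * h]; their continuity at [x] makes them agree there up to any [e]. *)
Lemma diff_diffC_real E (f : E -> R) (x u v : E) : class_C 2 setT f ->
  'd (fun y => 'd f y u) x v = 'd (fun y => 'd f y v) x u.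
Proof.
move=> fC; apply/eqP; rewrite -subr_eq0 -normr_le0; apply/ler_addgt0Pl => e e0.
rewrite addr0.
have dC (w w' : E) : {for x, continuous (fun z => 'd (fun y => 'd f y w) z w')}.
  exact: ((fC.2 w).2 w').
have e20 : 0 < e / 2 by rewrite divr_gt0.
have /cvgrPdist_lt/(_ _ e20)/nbhs_ballP[r1 r10 uv] := dC u v.
have /cvgrPdist_lt/(_ _ e20)/nbhs_ballP[r2 r20 vu] := dC v u.
(* With this [h], a displacement of at most [h] along each of [u] and [v] has norm less than [r];
   the added 1 keeps the denominator positive. *)
pose r := Num.min r1 r2; pose h := r / (`|u| + `|v| + 1).
have r0 : 0 < r by rewrite lt_min r10 r20.
have D0 : 0 < `|u| + `|v| + 1 by rewrite ltr_wpDl// addr_ge0.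
have h0 : 0 < h by rewrite divr_gt0.
have near_x (a b : R) (w w' : E) : `|w| + `|w'| = `|u| + `|v| ->
    0 <= a <= h -> 0 <= b <= h -> ball x r (x + a *: w + b *: w').
  move=> wE /andP[a0 ah] /andP[b0 bh]; rewrite -ball_normE /=.
  rewrite -addrA opprD addNKr normrN (le_lt_trans (ler_normD _ _))//.
  rewrite !normrZ !ger0_norm//.
  have -> : r = h * (`|u| + `|v| + 1) by rewrite divfK// gt_eqF.
  rewrite -wE; have := normr_ge0 w; have := normr_ge0 w'.
  nra.
have [a [b [ah bh Euv]]] := second_difference_mean_value x u v fC h0.
have [c [d [ch dh Evu]]] := second_difference_mean_value x v u fC h0.
(* The second difference is symmetric in [u] and [v], so the two mean value formulas compute the
   same number. *)
have uv_vu : 'd (fun y => 'd f y u) (x + a *: u + b *: v) v =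
    'd (fun y => 'd f y v) (x + c *: v + d *: u) u.
  apply: (mulIf (lt0r_neq0 h0)); apply: (mulIf (lt0r_neq0 h0)).
  by rewrite -Euv -Evu [x + h *: v + h *: u]addrAC; ring.
have := uv _ (le_ball _ (near_x a b u v erefl ah bh)).
have := vu _ (le_ball _ (near_x c d v u (addrC _ _) ch dh)).
rewrite /r !ge_min !lexx orbT /= => /(_ isT) vu' /(_ isT) uv'.
pose m := 'd (fun y => 'd f y u) (x + a *: u + b *: v) v.
rewrite [e]splitr ltW// (le_lt_trans (ler_distD m _ _))//.
by apply: ltrD uv' _; rewrite /m uv_vu distrC.
Qed.

Lemma diff_diffC E F (f : E -> F) (x u v : E) :
  finite_dimensional F -> class_C 2 setT f ->
  'd (fun y => 'd f y u) x v = 'd (fun y => 'd f y v) x u.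
Proof.
move=> [I [e [l [cl le]]]] fC; rewrite [LHS]le [RHS]le.
apply: eq_bigr => i _; congr (_ *: _).
have fd y : differentiable f y by exact: fC.1.
have fdd w y : differentiable (fun z => 'd f z w) y by exact: (fC.2 w).1.
have lE w : (fun y => l i ('d f y w)) = (fun y => 'd (l i \o f) y w).
  by apply/funext => y; rewrite diff_comp_linear.
rewrite -!diff_comp_linear// /comp !lE; apply: diff_diffC_real.
exact: class_C_comp_linear openT (cl i) fC.
Qed.

End schwarz.

(** * Partial derivatives, smooth maps on normed spaces, and derivatives of pull-backs *)

Section partial_derivatives.
Context {R : realType}.
Implicit Types E F : normedModType R.

Lemma is_diff_pairl E F (H : normedModType R) (f : E * F -> H) (x : E) (y : F) :
  differentiable f (x, y) ->
  is_diff y (fun y => f (x, y)) (fun w => 'd f (x, y) (0, w)).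
Proof.
move=> /differentiableP fd.
exact: (is_diff_comp (is_diff_pair (is_diff_cst x y) (is_diff_id y)) fd).
Qed.

Lemma is_diff_pairr E F (H : normedModType R) (f : E * F -> H) (x : E) (y : F) :
  differentiable f (x, y) ->
  is_diff x (fun x => f (x, y)) (fun w => 'd f (x, y) (w, 0)).
Proof.
move=> /differentiableP fd.
exact: (is_diff_comp (is_diff_pair (is_diff_id x) (is_diff_cst y x)) fd).
Qed.

Lemma diff_pair_split E F (H : normedModType R) (f : E * F -> H) p
  (v : E) (w : F) : 'd f p (v, w) = 'd f p (v, 0) + 'd f p (0, w).
Proof.
rewrite -linearD; congr ('d f p _).
by rewrite /GRing.add/= /add_pair/= addr0 add0r.
Qed.

Lemma diff_opp E F (f : E -> F) x v :
  differentiable f x -> 'd (fun y => - f y) x v = - 'd f x v.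
Proof. by move=> /diffN /(congr1 (@^~ v)). Qed.

Lemma is_derive_is_diff (E : normedModType R) (f : R -> E) (x : R) (c : E) :
  is_derive x 1 f c -> is_diff x f (fun v => v *: c).
Proof.
move=> [fd <-]; apply: DiffDef; first exact/derivable1_diffP.
by rewrite deriv1E// derive1E.
Qed.

Lemma is_derive_unique (E F : normedModType R) (f : E -> F) (x v : E) df df' :
  is_derive x v f df -> is_derive x v f df' -> df = df'.
Proof. by move=> [_ <-] [_ <-]. Qed.

Lemma is_derive_coord n (f : R -> 'rV[R]_n) (t : R) f' i :
  is_derive t 1 f f' -> is_derive t 1 (fun s => f s 0 i) (f' 0 i).
Proof.
move=> [fd <-]; split; first by move/derivable_mxP : fd; exact.
by rewrite derive_mx// mxE.
Qed.

Lemma is_derive_comp1 E F (f : E -> F) (c : R -> E) (t : R) c' :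
  is_derive t 1 c c' -> differentiable f (c t) ->
  is_derive t 1 (f \o c) ('d f (c t) c').
Proof.
move=> [cd <-] fd; have cd' := (derivable1_diffP _ _).1 cd.
rewrite deriveE//.
exact: is_diff_is_derive (1 : R)
  (is_diff_comp (differentiableP cd') (differentiableP fd)).
Qed.

Lemma is_derive_linear E F (l : {linear E -> F}) (c : R -> E) (t : R) c' :
  continuous l -> is_derive t 1 c c' -> is_derive t 1 (l \o c) (l c').
Proof.
move=> cl cd; apply: is_derive_eq (is_derive_comp1 cd _) _.
  exact: linear_differentiable.
by rewrite diff_lin.
Qed.

Lemma smooth_diff_apply E F (H : normedModType R) (a v : E -> F) (g : F -> H) :
  finite_dimensional F -> smooth_on setT a -> smooth_on setT v ->
  smooth_on setT g -> smooth_on setT (fun x => 'd g (a x) (v x)).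
Proof. by move=> fdF aC vC gC k; exact: class_C_diff_apply openT _ _ _. Qed.

Lemma smooth_comp E F (H : normedModType R) (f : E -> F) (g : F -> H) :
  finite_dimensional F -> smooth_on setT f -> smooth_on setT g ->
  smooth_on setT (g \o f).
Proof.
move=> fdF fC gC k.
by apply: (@class_C_comp _ _ _ _ _ _ setT) (gC k) => //; exact: openT.
Qed.

Lemma smooth_pair E F (H : normedModType R) (f : E -> F) (g : E -> H) :
  smooth_on setT f -> smooth_on setT g -> smooth_on setT (fun x => (f x, g x)).
Proof. by move=> fC gC k; apply: class_C_pair => //; exact: openT. Qed.

Lemma smooth_cst E F (a : F) : smooth_on setT (cst a : E -> F).
Proof. by move=> k; exact: class_C_cst. Qed.

Lemma smooth_linear E F (l : {linear E -> F}) :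
  continuous l -> smooth_on setT l.
Proof. by move=> cl k; exact: class_C_linear. Qed.

Lemma smooth_id E : smooth_on setT (@id E).
Proof. by apply: (smooth_linear (l := idfun)) => x. Qed.

Lemma smooth_fst E F : smooth_on setT (@fst E F).
Proof. by apply: (smooth_linear (l := fst)) => x; exact: cvg_fst. Qed.

Lemma smooth_snd E F : smooth_on setT (@snd E F).
Proof. by apply: (smooth_linear (l := snd)) => x; exact: cvg_snd. Qed.

Lemma smooth_scale (E F : normedModType R) (a : E -> R) (f : E -> F) :
  smooth_on setT a -> smooth_on setT f -> smooth_on setT (fun x => a x *: f x).
Proof. by move=> aC fC k; apply: class_C_scale => //; exact: openT. Qed.

Lemma smooth_add (E F : normedModType R) (f g : E -> F) :
  smooth_on setT f -> smooth_on setT g -> smooth_on setT (fun x => f x + g x).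
Proof. by move=> fC gC k; apply: class_CD => //; exact: openT. Qed.

Lemma smooth_differentiable E F (f : E -> F) x :
  smooth_on setT f -> differentiable f x.
Proof. by move=> fC; exact: (fC 1).1. Qed.

(** Each function is the derivative of the other up to sign, whence the joint induction. The sine
    later reparametrises segments in a chart: it is defined on all of [R] but bounded, so the curve
    never leaves the chart. *)
Lemma class_C_sin_cos k :
  class_C k setT (@sin R) /\ class_C k setT (@cos R).
Proof.
elim: k => [|k [sC cC]].
  by split=> x _; [exact: continuous_sin|exact: continuous_cos].
split.
  apply: (@class_CS R R R k setT sin (fun x v : R => v *: cos x) openT) => [x _|v].
    exact: is_derive_is_diff.
  by apply: class_C_scale => //; [exact: openT|exact: class_C_cst].
apply: (@class_CS R R R k setT cos (fun x v : R => v *: (- sin x)) openT) => [x _|v].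
  exact: is_derive_is_diff.
under eq_fun do rewrite scalerN -scaleNr.
by apply: class_C_scale => //; [exact: openT|exact: class_C_cst].
Qed.

(* [K (s, _)] is inverse to the diffeomorphism [f (s, _)], both being the
   identity at [s = s0]; the left-hand side is the pull-back of [Y] by
   [f (s, _)]. The mixed derivative of [K] is where [- 'd xi x (Y x)] comes
   from. *)
Lemma is_derive_pull_back n (f K : R * 'rV[R]_n -> 'rV[R]_n)
  (Y : 'rV[R]_n -> 'rV[R]_n) (s0 : R) x :
  smooth_on setT f -> smooth_on setT K -> smooth_on setT Y ->
  (forall y, f (s0, y) = y) -> (forall y, K (s0, y) = y) ->
  (forall s y, K (s, f (s, y)) = y) ->
  is_derive s0 1 (fun s => 'd K (s, f (s, x)) (0, Y (f (s, x))))
    (lie_bracket (fun y => 'd f (s0, y) (1, 0)) Y x).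
Proof.
move=> fC KC YC f0 K0 Kf.
have fdn := finite_dimensional_rV n : finite_dimensional ('rV[R]_n).
have fdp := finite_dimensional_prod (@finite_dimensional_real R) fdn.
pose xi y := 'd f (s0, y) (1, 0).
have xiC : smooth_on setT xi.
  apply: smooth_diff_apply => //; last exact: smooth_cst.
  by apply: smooth_pair; [exact: smooth_cst|exact: smooth_id].
pose P p := 'd K p (0, Y p.2).
have PC : smooth_on setT P.
  apply: smooth_diff_apply => //; first exact: smooth_id.
  apply: smooth_pair; first exact: smooth_cst.
  by apply: smooth_comp => //; exact: smooth_snd.
have dK0 y w : 'd K (s0, y) (0, w) = w.
  have := is_diff_pairl (smooth_differentiable (s0, y) KC).
  rewrite (_ : (fun y => K (s0, y)) = id); last by apply/funext.
  by move=> [_ /(congr1 (@^~ w)) <-]; rewrite diff_val.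
have dfline y : is_diff s0 (fun s : R => (s, f (s, y))) (fun v => (v, v *: xi y)).
  have fd := is_diff_pairr (smooth_differentiable (s0, y) fC).
  have := is_diff_pair (is_diff_id s0) fd; congr is_diff_def.
  apply/funext => v; rewrite /xi -linearZ; congr (_, 'd f _ _).
  by rewrite /GRing.scale /= /scale_pair scaler0 [_ *: 1]mulr1.
(* Obtained by differentiating [K (s, f (s, y)) = y] in [s] at [s0]. *)
have Kxi y : 'd K (s0, y) (1, 0) = - xi y.
  apply/eqP; rewrite -addr_eq0 -[X in _ + X](dK0 y) -diff_pair_split.
  have Kd : is_diff (s0, f (s0, y)) K ('d K (s0, y)).
    by rewrite f0; apply: differentiableP; exact: smooth_differentiable.
  have := is_diff_comp (dfline y) Kd.
  rewrite (_ : K \o _ = cst y); last by apply/funext => s; exact: Kf.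
  by move=> [_ /(congr1 (@^~ 1))]; rewrite diff_cst /= scale1r => <-.
(* Exchanging the two derivatives of [K], the time derivative of ['d K (s, x) (0, Y x)] is the
   derivative in direction [Y x] of [y |-> 'd K (s0, y) (1, 0)], which is [- xi]. *)
have PE : 'd P (s0, x) (1, 0) = - 'd xi x (Y x).
  have KvC : smooth_on setT (fun p => 'd K p (0, Y x)).
    by apply: smooth_diff_apply => //; [exact: smooth_id|exact: smooth_cst].
  have K1C : smooth_on setT (fun p => 'd K p (1, 0)).
    by apply: smooth_diff_apply => //; [exact: smooth_id|exact: smooth_cst].
  have [_ /(congr1 (@^~ 1))/= <-] :=
    is_diff_pairr (smooth_differentiable (s0, x) PC).
  rewrite [in LHS]/P /=.
  have [_ /(congr1 (@^~ 1))/= ->] :=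
    is_diff_pairr (smooth_differentiable (s0, x) KvC).
  rewrite diff_diffC//.
  have [_ /(congr1 (@^~ (Y x)))/= <-] :=
    is_diff_pairl (smooth_differentiable (s0, x) K1C).
  rewrite (_ : (fun y => 'd K (s0, y) (1, 0)) =
    (fun y => - xi y)); last first.
    by apply/funext => y; exact: Kxi.
  exact: diff_opp (smooth_differentiable x xiC).
have PE' w : 'd P (s0, x) (0, w) = 'd Y x w.
  have := is_diff_pairl (smooth_differentiable (s0, x) PC).
  rewrite (_ : (fun y => P (s0, y)) = Y); last by apply/funext => y; exact: dK0.
  by move=> [_ ->].
have Pd : is_diff (s0, f (s0, x)) P ('d P (s0, x)).
  by rewrite f0; apply: differentiableP; exact: smooth_differentiable.
have E : 'd P (s0, x) (1, 1 *: xi x) = lie_bracket xi Y x.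
  by rewrite diff_pair_split PE PE' scale1r; exact: addrC.
have D := is_diff_is_derive (1 : R) (is_diff_comp (dfline x) Pd).
exact: is_derive_eq D E.
Qed.

End partial_derivatives.

(** * Smooth maps between manifolds *)

Section smooth_maps.
Context {R : realType}.

(** What composition and pairing use of an atlas. It passes to product atlases with no computation
    on transition maps. *)
Definition covering_charts (M : topologicalType) (E : normedModType R)
    (A : set (chart M E)) :=
  (forall c, A c -> is_chart c) /\ (forall p, exists2 c, A c & cdom c p).

Lemma smooth_atlas_covering (M : topologicalType) (E : normedModType R)
  (A : set (chart M E)) : smooth_atlas A -> covering_charts A.
Proof. by case. Qed.

Lemma std_atlas_covering (E : normedModType R) : covering_charts (std_atlas E).
Proof.
split=> [c ->|p]; last by exists (Chart [set: E] [set: E] id id).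
by split=> //=; [split; exact: openT|..]; apply: continuous_subspaceT => x.
Qed.

Lemma is_chart_fwd (M : topologicalType) (E : normedModType R) (c : chart M E)
  p : is_chart c -> cdom c p -> {for p, continuous (fwd c)}.
Proof.
move=> [[oc _] _ _ + _] cp; rewrite continuous_open_subspace//.
by apply; exact/mem_set.
Qed.

Lemma is_chart_bwd (M : topologicalType) (E : normedModType R) (c : chart M E)
  y : is_chart c -> ccod c y -> {for y, continuous (bwd c)}.
Proof.
move=> [[_ oc] _ _ _] + cy; rewrite continuous_open_subspace//.
by apply; exact/mem_set.
Qed.

Lemma open_setX (M N : topologicalType) (A : set M) (B : set N) :
  open A -> open B -> open (A `*` B).
Proof.
rewrite !openE => oA oB [p q] [/= Ap Bq]; exists (A, B) => //=.
by split; [exact: oA|exact: oB].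
Qed.

Lemma open_preimage (M N : topologicalType) (f : M -> N) (B : set N) :
  continuous f -> open B -> open (f @^-1` B).
Proof. by move=> fc; apply: open_comp => x _; exact: fc. Qed.

Lemma prod_atlas_covering (M N : topologicalType) (E F : normedModType R)
  (A : set (chart M E)) (B : set (chart N F)) :
  covering_charts A -> covering_charts B -> covering_charts (prod_atlas A B).
Proof.
move=> [Ac Acov] [Bc Bcov]; split=> [_ [c [c' [/Ac cc /Bc cc' ->]]]|[p q]].
  have [[oc1 oc2] cK cK' _ _] := cc; have [[od1 od2] dK dK' _ _] := cc'.
  have o1 : open (cdom (prod_chart c c')) by exact: open_setX.
  have o2 : open (ccod (prod_chart c c')) by exact: open_setX.
  split=> //.
  - by move=> [p q] /= [/cK[? ?] /dK[? ?]]; split=> //; congr pair.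
  - by move=> [p q] /= [/cK'[? ?] /dK'[? ?]]; split=> //; congr pair.
  - rewrite continuous_open_subspace// => -[p q] /set_mem[/= cp cq].
    apply: cvg_pair; apply: continuous_comp; do ?[exact: cvg_fst|exact: cvg_snd].
      exact: is_chart_fwd.
    exact: is_chart_fwd.
  - rewrite continuous_open_subspace// => -[p q] /set_mem[/= cp cq].
    apply: cvg_pair; apply: continuous_comp; do ?[exact: cvg_fst|exact: cvg_snd].
      exact: is_chart_bwd.
    exact: is_chart_bwd.
have [c Acc cp] := Acov p; have [c' Bc' cq] := Bcov q.
by exists (prod_chart c c') => //; exists c, c'.
Qed.

Lemma open_chart_preimage (M : topologicalType) (E : normedModType R)
  (c : chart M E) (W : set M) :
  is_chart c -> open W -> open (ccod c `&` bwd c @^-1` W).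
Proof.
move=> cc oW; rewrite openE => y [cy Wy]; rewrite /interior /=.
have [[_ oc] _ _ _ _] := cc.
apply: filterI; first exact: open_nbhs_nbhs.
exact: (is_chart_bwd cc cy) (open_nbhs_nbhs (conj oW Wy)).
Qed.

(** Near a given point a chart [b] of the middle manifold is inserted; on the open set where [f]
    stays in [b], the coordinate expression of [g \o f] is the composite of those of [f] and [g]. *)
Lemma smooth_map_comp (M N P : topologicalType) (E F H : normedModType R)
  (A : set (chart M E)) (B : set (chart N F)) (C : set (chart P H))
  (f : M -> N) (g : N -> P) :
  finite_dimensional F ->
  covering_charts A -> covering_charts B -> covering_charts C ->
  smooth_map A B f -> smooth_map B C g -> smooth_map A C (g \o f).
Proof.
move=> fdF [Ac _] [Bc Bcov] [Cc _] [fc fC] [gc gC].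
have gfc : continuous (g \o f).
  by move=> x; apply: continuous_comp; [exact: fc|exact: gc].
split=> // c c' Acc Cc' k.
apply: class_C_local => y [/= cy gy].
have [b Bb fb] := Bcov (f (bwd c y)).
have [[ob _] bK _ _ _] := Bc _ Bb.
have [[oc' _] _ _ _ _] := Cc _ Cc'.
pose W := (f @^-1` cdom b) `&` ((g \o f) @^-1` cdom c').
have oW : open W.
  by apply: openI; [exact: open_preimage|exact: (open_preimage gfc)].
exists (ccod c `&` bwd c @^-1` W); first by [].
have oU := open_chart_preimage (Ac _ Acc) oW.
apply: (@eq_class_C _ _ _ _ _ ((fwd c' \o g \o bwd b) \o (fwd b \o f \o bwd c))).
- exact: oU.
- by move=> x [_ [/= bx _]]; rewrite (bK _ bx).2.
- apply: class_C_comp (gC _ _ Bb Cc' k) => //.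
  + move=> x [cx [/= bx gx]]; split=> /=; rewrite ?(bK _ bx).2//.
    exact: (bK _ bx).1.
  + by apply: class_C_subset (fC _ _ Acc Bb k) => x [cx [bx _]].
Qed.

Lemma smooth_map_pair (M N P : topologicalType) (E F H : normedModType R)
  (A : set (chart M E)) (B : set (chart N F)) (C : set (chart P H))
  (f : M -> N) (g : M -> P) :
  covering_charts A -> covering_charts B -> covering_charts C ->
  smooth_map A B f -> smooth_map A C g ->
  smooth_map A (prod_atlas B C) (fun x => (f x, g x)).
Proof.
move=> [Ac _] Bc Cc [fc fC] [gc gC].
have fgc : continuous (fun x => (f x, g x)).
  by move=> x; apply: cvg_pair; [exact: fc|exact: gc].
split=> // c _ Acc [b [c' [Bb Cc' ->]]] k.
have [[od _] _ _ _ _] : is_chart (prod_chart b c').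
  by apply: (prod_atlas_covering Bc Cc).1; exists b, c'.
apply: class_C_pair.
- apply: open_chart_preimage; first exact: Ac.
  exact: open_preimage.
- by apply: class_C_subset (fC _ _ Acc Bb k) => x [cx [bx _]].
- by apply: class_C_subset (gC _ _ Acc Cc' k) => x [cx [_ cx']].
Qed.

Lemma smooth_map_cst (M N : topologicalType) (E F : normedModType R)
  (A : set (chart M E)) (B : set (chart N F)) (b : N) :
  smooth_map A B (cst b).
Proof.
split=> [x|c c' _ _ k]; first exact: cvg_cst.
exact: (class_C_cst k _ (fwd c' b)).
Qed.

Lemma smooth_map_std (E F : normedModType R) (f : E -> F) :
  smooth_map (std_atlas E) (std_atlas F) f <-> smooth_on setT f.
Proof.
split=> [[fc fC] k|fC]; first by apply: class_C_subset (fC _ _ erefl erefl k).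
split=> [x|_ _ -> -> k]; first exact: (class_C_continuous (fC 0%N) I).
exact: class_C_subset (fC k).
Qed.

Lemma smooth_map_bwd (M : topologicalType) (E F : normedModType R)
  (A : set (chart M E)) (c : chart M E) (f : F -> E) :
  finite_dimensional E -> smooth_atlas A -> A c ->
  smooth_on setT f -> (forall x, ccod c (f x)) ->
  smooth_map (std_atlas F) A (bwd c \o f).
Proof.
move=> fdE [Ac Acov Asm] Acc fC fc.
have bfC : continuous (bwd c \o f).
  move=> x; apply: continuous_comp; first exact: (class_C_continuous (fC 0%N) I).
  exact: is_chart_bwd (Ac _ Acc) (fc x).
split=> // _ c' -> Ac' k /=.
have [[oc' _] _ _ _ _] := Ac _ Ac'.
have -> : fwd c' \o (bwd c \o f) \o id = (fwd c' \o bwd c) \o f by [].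
apply: class_C_comp (Asm _ _ Acc Ac' k) => //.
- by rewrite setTI; exact: (open_preimage bfC oc').
- by move=> x [_ /= fx]; split.
- exact: class_C_subset (fC k).
Qed.

End smooth_maps.

(** * Finite-dimensional spaces of vector fields and linear equations *)

Section finite_dimensional_fields.
Context {R : realType} {n : nat}.
Notation field := ('rV[R]_n -> 'rV[R]_n).
Implicit Type V : set field.

Definition linear_closed_fields V :=
  V (cst 0) /\ forall a f g, V f -> V g -> V (fun x => a *: f x + g x).

(** Coordinates of values at finitely many points act as linear coordinates on [V]. The expansion is
    pointwise in [x] and linear in [f], so it survives differentiation in a parameter and can be
    used to test membership in [V]. *)
Definition evaluation_frame V (I : finType) (p : I -> 'rV[R]_n) (c : I -> 'I_n)
    (u : I -> field) :=
  (forall i, V (u i)) /\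
  (forall f, V f -> forall x, f x = \sum_i f (p i) 0 (c i) *: u i x).

Lemma linear_closed_scale V a f : linear_closed_fields V ->
  V f -> V (fun x => a *: f x).
Proof.
move=> [V0 VD] Vf; have := VD a _ _ Vf V0.
by congr V; apply/funext => x; rewrite addr0.
Qed.

Lemma linear_closed_add V f g : linear_closed_fields V ->
  V f -> V g -> V (fun x => f x + g x).
Proof.
move=> [V0 VD] Vf Vg; have := VD 1 _ _ Vf Vg.
by congr V; apply/funext => x; rewrite scale1r.
Qed.

Lemma linear_closed_sum V (I : Type) (r : seq I) (a : I -> R) (f : I -> field) :
  linear_closed_fields V -> (forall i, V (f i)) ->
  V (fun x => \sum_(i <- r) a i *: f i x).
Proof.
move=> [V0 VD] Vf; elim: r => [|i r IH].
  by under eq_fun do rewrite big_nil.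
under eq_fun do rewrite big_cons.
exact: VD.
Qed.

Lemma findim_linear_closed V : findim_space_of_fields V -> linear_closed_fields V.
Proof.
move=> [m [e [_ ->]]]; split=> [|a f g [b ->] [b' ->]] /=.
  by exists (fun=> 0); apply/funext => x; rewrite big1// => i _; rewrite scale0r.
exists (fun i => a * b i + b' i); apply/funext => x.
rewrite scaler_sumr -big_split; apply: eq_bigr => i _.
by rewrite scalerDl scalerA.
Qed.

Lemma findim_smooth V f : findim_space_of_fields V -> V f -> smooth_on setT f.
Proof.
move=> [m [e [eC ->]]] [a ->] k; apply: class_C_sum; first exact: openT.
move=> i; apply: class_C_scale (eC i k); first exact: openT.
exact: class_C_cst.
Qed.

(* In the induction step [f] is the part of the new field missed by the frame
   built so far. If [f] is nonzero at [x0] in coordinate [c0], this evaluation is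
   added to the frame and the old frame fields are corrected by multiples of [f]
   that vanish under it. *)
Lemma evaluation_frame_seq V m (e : nat -> field) : linear_closed_fields V ->
  (forall j, (j < m)%N -> V (e j)) ->
  exists (I : finType) (p : I -> 'rV[R]_n) (c : I -> 'I_n) (u : I -> field),
  (forall i, V (u i)) /\ (forall j, (j < m)%N -> forall x,
     e j x = \sum_i e j (p i) 0 (c i) *: u i x).
Proof.
move=> Vlin; elim: m => [|m IH] Ve.
  exists void, (of_void _), (of_void _), (of_void _).
  by split=> // -[].
have [j jm|I [p [c [u [Vu eE]]]]] := IH; first by apply: Ve; rewrite ltnW.
pose P (h : field) x := \sum_i h (p i) 0 (c i) *: u i x.
pose f x := - 1 *: P (e m) x + e m x.
have Vf : V f.
  by apply: Vlin.2; [exact: linear_closed_sum|exact: Ve].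
have [f0|] := pselect (forall x, f x = 0).
  exists I, p, c, u; split=> // j; rewrite ltnS leq_eqVlt => /orP[/eqP->|].
    by move=> x; have /eqP := f0 x; rewrite /f scaleN1r addrC subr_eq0 => /eqP.
  exact: eE.
move=> /existsNP[x0 /eqP/rV0Pn[c0 fN0]].
pose p' (k : I + unit) := if k is inl i then p i else x0.
pose c' (k : I + unit) := if k is inl i then c i else c0.
pose u' (k : I + unit) : field := fun x => if k is inl i
  then - (u i x0 0 c0 / f x0 0 c0) *: f x + u i x else (f x0 0 c0)^-1 *: f x.
exists (I + unit)%type, p', c', u'; split=> [[i|[]]|].
- by apply: Vlin.2.
- exact: linear_closed_scale.
move=> j jm x.
(* Each field is what the old frame predicts plus a multiple of [f]: the multiple is 1 for the new
   field and 0 for the others. *)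
have [a aE] : exists a, forall y, e j y = P (e j) y + a *: f y.
  move: jm; rewrite ltnS leq_eqVlt => /orP[/eqP->|/eE jE].
    by exists 1 => y; rewrite scale1r /f scaleN1r addrA addrN add0r.
  by exists 0 => y; rewrite scale0r addr0; exact: jE.
rewrite big_sumType /= [X in _ + X]big_const card_unit /= addr0.
under eq_bigr do rewrite scalerDr addrC.
rewrite big_split /= -/(P (e j) x) [LHS]aE -addrA; congr (_ + _).
under eq_bigr do rewrite scalerA mulrN mulrA scaleNr.
rewrite sumrN -scaler_suml -mulr_suml scalerA -scaleNr -scalerDl -mulNr -mulrDl.
(* What remains is that the total coefficient of [f], namely coordinate [c0] of
   [e j x0 - P (e j) x0] divided by that of [f x0], is [a]. *)
congr (_ *: _); apply: (mulIf fN0); rewrite divfK//.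
rewrite [e j x0]aE [(_ + a *: f x0) _ _]mxE [(a *: f x0) _ _]mxE {1}/P summxE.
have -> : \sum_i e j (p i) 0 (c i) * u i x0 0 c0 =
  \sum_i (e j (p i) 0 (c i) *: u i x0) 0 c0.
  by apply: eq_bigr => i _; rewrite mxE.
by rewrite addKr.
Qed.

Lemma evaluation_frame_exists V : findim_space_of_fields V ->
  exists (I : finType) (p : I -> 'rV[R]_n) (c : I -> 'I_n) (u : I -> field),
    evaluation_frame V p c u.
Proof.
move=> fV; have Vlin := findim_linear_closed fV.
have [m [e [_ VE]]] := fV.
have Ve i : V (e i).
  rewrite VE; exists (fun j => (j == i)%:R); apply/funext => x.
  rewrite (bigD1 i)//= eqxx scale1r big1 ?addr0// => j /negbTE->.
  by rewrite scale0r.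
(* The generators are extended by the zero field to all natural indices, as the induction on their
   number requires. *)
pose e' j := if insub j is Some i then e i else cst 0.
have [j _|I [p [c [u [Vu eE]]]]] := @evaluation_frame_seq V m e' Vlin.
  by rewrite /e'; case: insubP => [i _ _|_]; [exact: Ve|exact: Vlin.1].
exists I, p, c, u; split=> // f; rewrite VE => -[a ->] x.
have eE' (j : 'I_m) y : e j y = \sum_i e j (p i) 0 (c i) *: u i y.
  by have := eE j (ltn_ord j) y; rewrite /e' valK.
under [RHS]eq_bigr do rewrite summxE scaler_suml.
rewrite exchange_big /=; apply: eq_bigr => j _.
rewrite [in LHS]eE' scaler_sumr; apply: eq_bigr => i _.
by rewrite mxE scalerA.
Qed.

End finite_dimensional_fields.

(** * Uniqueness for homogeneous linear differential systems *)

Section linear_ode.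
Context {R : realType}.

Lemma is_derive_big (V W : normedModType R) (I : Type) (r : seq I)
  (h : I -> V -> W) (dh : I -> W) (x v : V) :
  (forall i, is_derive x v (h i) (dh i)) ->
  is_derive x v (fun y => \sum_(i <- r) h i y) (\sum_(i <- r) dh i).
Proof.
move=> dhE; elim: r => [|i r IH].
  by rewrite big_nil; under eq_fun do rewrite big_nil; exact: is_derive_cst.
by rewrite big_cons; under eq_fun do rewrite big_cons; exact: is_deriveD.
Qed.

(** A Gronwall argument: the sum of squares [q] satisfies [q' <= 2 K q] on [[0, T]], so
    [expR (- 2 K s) * q s] is nonincreasing there; it is nonnegative and starts at 0. *)
Lemma linear_ode_zero (I : finType) (w : I -> R -> R) (A : I -> I -> R -> R)
  (T : R) :
  (forall i (s : R), is_derive s 1 (w i) (\sum_j A i j s * w j s)) ->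
  (forall i j, continuous (A i j)) ->
  (forall i, w i 0 = 0) -> 0 <= T -> forall i, w i T = 0.
Proof.
move=> dw Ac w0 T0.
pose B s := \sum_i \sum_j `|A i j s|.
pose q s := \sum_i (w i s) ^+ 2.
pose dq s := \sum_i w i s *+ 2 * (\sum_j A i j s * w j s).
have Bc : continuous B.
  have sumC (J : finType) (g : J -> R -> R) : (forall j, continuous (g j)) ->
      continuous (fun s => \sum_j g j s).
    move=> gc s.
    have gC : class_C 0 setT (fun s => \sum_j g j s).
      by apply: class_C_sum => // [|j x _]; [exact: openT|exact: gc].
    exact: class_C_continuous gC Logic.I.
  by apply: (sumC) => i; apply: sumC => j s; apply: cvg_norm; exact: Ac.
(* [K] is the maximum over [[0, T]] of the sum of the absolute values of the coefficients. *)
have [K KB] : exists K, forall s, s \in `[0, T] -> B s <= K.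
  have [//||s _ sB] := @EVT_max R B 0 T; first exact: continuous_subspaceT.
  by exists (B s).
have q0 s : 0 <= q s by apply: sumr_ge0 => i _; exact: sqr_ge0.
have wq i s : w i s ^+ 2 <= q s.
  by rewrite /q (bigD1 i)//= lerDl sumr_ge0// => j _; exact: sqr_ge0.
have dqE (s : R) : is_derive s 1 q (dq s).
  apply: (@is_derive_big R R I (index_enum I) (fun i s => w i s ^+ 2)) => i.
  have -> : (fun s => w i s ^+ 2) = w i * w i by [].
  apply: is_derive_eq (is_deriveM (dw i s) (dw i s)) _.
  by rewrite -scalerDl mulr2n.
(* Term by term, [x * y] is at most [(x ^+ 2 + y ^+ 2) / 2] in absolute value, and each square is at
   most [q s]. *)
have dqB s : dq s <= B s *+ 2 * q s.
  rewrite /dq /B -sumrMnl mulr_suml; apply: ler_sum => i _.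
  rewrite mulr_sumr -sumrMnl mulr_suml; apply: ler_sum => j _.
  have := wq i s; have := wq j s; have := q0 s; have := ler_norm (A i j s).
  have := lerNnormlW (lexx `|A i j s|).
  have := sqr_ge0 (w i s - w j s); have := sqr_ge0 (w i s + w j s).
  move: (w i s) (w j s) (A i j s) `|A i j s| (q s) => x y a b z; nra.
pose phi s := expR (- (K *+ 2) * s) * q s.
pose dphi s := expR (- (K *+ 2) * s) * (dq s - K *+ 2 * q s).
have dphiE (s : R) : is_derive s 1 phi (dphi s).
  have de : is_derive s 1 (fun s : R => expR (- (K *+ 2) * s))
     (expR (- (K *+ 2) * s) * - (K *+ 2)).
    apply: is_derive1_comp.
    have := is_diff_is_derive (1 : R) (is_diff_scaler (- (K *+ 2)) s).
    by rewrite [_ *: 1]mulr1.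
  apply: is_derive_eq (is_deriveM de (dqE s)) _.
  rewrite /dphi -[_ *: dq s]/(_ * _) -[q s *: _]/(_ * _); ring.
have phi0 : phi 0 = 0.
  by rewrite /phi /q big1 ?mulr0// => i _; rewrite w0 expr0n.
have : phi T <= phi 0.
  apply: (@ler0_derive1_le_cc R phi 0 T) => // [s sT|||].
  - have [_] := dphiE s; rewrite derive1E => ->.
    rewrite /dphi pmulr_rle0 ?expR_gt0// subr_le0 (le_trans (dqB s))//.
    by rewrite ler_wpM2r// lerMn2r KB//; exact: subset_itv_oo_cc sT.
  - apply: continuous_subspaceT => s.
    by apply: differentiable_continuous; apply/derivable1_diffP; case: (dphiE s).
  - by rewrite in_itv /= lexx T0.
  - by rewrite in_itv /= lexx T0.
rewrite phi0 pmulr_rle0 ?expR_gt0// => qT i; apply/eqP.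
by rewrite -sqrf_eq0 eq_le sqr_ge0 andbT (le_trans (wq i T)).
Qed.

End linear_ode.

(** * Lie group actions *)

Section group_actions.
Context {R : realType} {n d : nat} {G : topologicalGroupCarrierType}.
Variables (A : set (chart G 'rV[R]_d)) (Phi : G -> 'rV[R]_n -> 'rV[R]_n).
Hypotheses (hG : lie_group A) (hPhi : lie_group_action A Phi).
Notation field := ('rV[R]_n -> 'rV[R]_n).
Implicit Types (g h : R -> G) (a b : G) (Y : field).

Let fdR : finite_dimensional (R : normedModType R) := finite_dimensional_real.
Let fdn : finite_dimensional 'rV[R]_n := finite_dimensional_rV n.
Let fdd : finite_dimensional 'rV[R]_d := finite_dimensional_rV d.
Let fdRn : finite_dimensional (R * 'rV[R]_n)%type :=
  finite_dimensional_prod fdR fdn.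

Let Aatlas : smooth_atlas A. Proof. by case: hG. Qed.
Let Acov : covering_charts A := smooth_atlas_covering Aatlas.
Let PhiM a b x : Phi (a * b)%g x = Phi a (Phi b x).
Proof. by case: hPhi. Qed.
Let Phi1 x : Phi 1%g x = x. Proof. by case: hPhi. Qed.

Lemma action_invK a : cancel (Phi a) (Phi a^-1%g).
Proof. by move=> x; rewrite -PhiM mulVg Phi1. Qed.

Lemma action_Kinv a : cancel (Phi a^-1%g) (Phi a).
Proof. by move=> x; rewrite -PhiM mulgV Phi1. Qed.

Lemma smooth_curve_cst a : smooth_curve A (cst a).
Proof. exact: smooth_map_cst. Qed.

Lemma smooth_curveV g : smooth_curve A g -> smooth_curve A (fun s => (g s)^-1%g).
Proof.
move=> gC; have [_ _ _ iC] := hG.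
exact: smooth_map_comp fdd (std_atlas_covering _) Acov Acov gC iC.
Qed.

Lemma smooth_curveM g h : smooth_curve A g -> smooth_curve A h ->
  smooth_curve A (fun s => (g s * h s)%g).
Proof.
move=> gC hC; have [_ _ mC _] := hG.
apply: (smooth_map_comp _ _ _ _ (f := fun s => (g s, h s)) _ mC) => //.
- exact: finite_dimensional_prod.
- exact: std_atlas_covering.
- exact: prod_atlas_covering.
- exact: smooth_map_pair (std_atlas_covering _) Acov Acov gC hC.
Qed.

Definition flow g (p : R * 'rV[R]_n) := Phi (g p.1) p.2.

Lemma smooth_flow g : smooth_curve A g -> smooth_on setT (flow g).
Proof.
move=> gC; have [PhiC _ _] := hPhi; apply/smooth_map_std.
apply: (smooth_map_comp _ _ _ _ (f := fun p => (g p.1, p.2)) _ PhiC) => //.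
- exact: finite_dimensional_prod.
- exact: std_atlas_covering.
- by apply: prod_atlas_covering => //; exact: std_atlas_covering.
- exact: std_atlas_covering.
apply: smooth_map_pair => //; do ?exact: std_atlas_covering.
- apply: (smooth_map_comp _ _ _ _ _ gC) => //; do ?exact: std_atlas_covering.
  by apply/smooth_map_std; exact: smooth_fst.
- by apply/smooth_map_std; exact: smooth_snd.
Qed.

Lemma smooth_action a : smooth_on setT (Phi a).
Proof.
have FC := smooth_flow (smooth_curve_cst a).
apply: (smooth_comp (f := fun x => (0 : R, x)) fdRn _ FC).
by apply: smooth_pair; [exact: smooth_cst|exact: smooth_id].
Qed.

Lemma action_differentiable a x : differentiable (Phi a) x.
Proof. exact/smooth_differentiable/smooth_action. Qed.

(** The push-forward of [Y] by the diffeomorphism [Phi a]. *)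
Definition push a Y : field :=
  fun x => 'd (Phi a) (Phi a^-1%g x) (Y (Phi a^-1%g x)).

Lemma push1 Y : push 1%g Y = Y.
Proof.
apply/funext => x; rewrite /push invg1.
have -> : Phi 1%g = id by apply/funext => y; rewrite Phi1.
by rewrite diff_val.
Qed.

Lemma pushM a b Y : push (a * b)%g Y = push a (push b Y).
Proof.
apply/funext => x; rewrite /push.
have -> : Phi (a * b)%g = Phi a \o Phi b by apply/funext => y; rewrite PhiM.
rewrite invgM PhiM.
set z := Phi a^-1%g x; set y := Phi b^-1%g z.
have := diff_comp (action_differentiable b y) (action_differentiable a (Phi b y)).
rewrite [Phi b y in X in _ = X -> _]action_Kinv => D.
exact: (congr1 (@^~ (Y y)) D).
Qed.

(** When [g t = 1] this is the fundamental field of the tangent vector of [g] at [t]. *)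
Definition velocity g t : field := fun x => derive1 (fun s => Phi (g s) x) t.

Lemma is_derive_velocity g (t : R) x : smooth_curve A g ->
  is_derive t 1 (fun s => Phi (g s) x) ('d (flow g) (t, x) (1, 0)).
Proof.
move=> /smooth_flow FC.
exact: is_diff_is_derive (is_diff_pairr (smooth_differentiable (t, x) FC)).
Qed.

Lemma velocityE g t x : smooth_curve A g ->
  velocity g t x = 'd (flow g) (t, x) (1, 0).
Proof.
by move=> /(is_derive_velocity t x)[_]; rewrite /velocity derive1E.
Qed.

Lemma diff_action g t x v : smooth_curve A g ->
  'd (Phi (g t)) x v = 'd (flow g) (t, x) (0, v).
Proof.
move=> /smooth_flow FC.
by have [_ ->] := is_diff_pairl (smooth_differentiable (t, x) FC).
Qed.

Lemma smooth_velocity g t : smooth_curve A g -> smooth_on setT (velocity g t).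
Proof.
move=> gC; rewrite (_ : velocity g t = fun x => 'd (flow g) (t, x) (1, 0)).
  apply: smooth_diff_apply => //; last exact: smooth_flow.
    by apply: smooth_pair; [exact: smooth_cst|exact: smooth_id].
  exact: smooth_cst.
by apply/funext => x; rewrite velocityE.
Qed.

(** Conjugating the flow by [Phi a] conjugates the curve by [a]: this is the adjoint action, read on
    fundamental fields. *)
Lemma push_velocity a g t : smooth_curve A g -> g t = 1%g ->
  push a (velocity g t) = velocity (fun s => a * g s * a^-1)%g t.
Proof.
move=> gC gt1; apply/funext => x; rewrite /push /velocity.
set y := Phi a^-1%g x.
have -> : (fun s => Phi (a * g s * a^-1)%g x) = Phi a \o (fun s => Phi (g s) y).
  by apply/funext => s; rewrite /= !PhiM.
have dg := is_derive_velocity t y gC.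
have [_ dad] := is_derive_comp1 dg (action_differentiable a (Phi (g t) y)).
rewrite !derive1E dad gt1 Phi1; congr ('d (Phi a) y _).
by case: dg.
Qed.

(** The spatial part of the push-forward of the field [(1, X)] on space-time. Being a single
    differential of [flow g], it is visibly smooth in [(t, x)] jointly. *)
Lemma star_actionE g X t x : smooth_curve A g ->
  star_action Phi g X t x =
  'd (flow g) (t, Phi (g t)^-1%g x) (1, X t (Phi (g t)^-1%g x)).
Proof.
by move=> gC; rewrite diff_pair_split -diff_action// -velocityE.
Qed.

Lemma smooth_star_action g X : smooth_curve A g ->
  smooth_on setT (fun p : R * 'rV[R]_n => X p.1 p.2) ->
  smooth_on setT (fun p : R * 'rV[R]_n => star_action Phi g X p.1 p.2).
Proof.
move=> gC XC.
have KC : smooth_on setT (fun p : R * 'rV[R]_n => (p.1, Phi (g p.1)^-1%g p.2)).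
  apply: smooth_pair; first exact: smooth_fst.
  exact: smooth_flow (smooth_curveV gC).
under eq_fun do rewrite star_actionE//.
apply: smooth_diff_apply => //; last exact: smooth_flow.
apply: smooth_pair; first exact: smooth_cst.
exact: smooth_comp fdRn KC XC.
Qed.

(** Writing [g s] as [(g s * (g t)^-1) * g t] makes the first summand the velocity of a curve that
    passes through 1 at time [t]. *)
Lemma star_action_split g X t : star_action Phi g X t =
  fun x => velocity (fun s => g s * (g t)^-1)%g t x + push (g t) (X t) x.
Proof.
apply/funext => x; rewrite /star_action /velocity; congr (derive1 _ t + _).
by apply/funext => s; rewrite PhiM.
Qed.

(** Pushing by the inverse is pulling back by [Phi (h s)], so the pull-back formula applies with the
    flows of [h] and of its inverse curve. *)
Lemma is_derive_push1 h (s0 : R) Y x : smooth_curve A h -> h s0 = 1%g ->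
  smooth_on setT Y ->
  is_derive s0 1 (fun s => push (h s)^-1%g Y x) (lie_bracket (velocity h s0) Y x).
Proof.
move=> hC h1 YC; have vC := smooth_curveV hC.
have := is_derive_pull_back (s0 := s0) x (smooth_flow hC) (smooth_flow vC) YC.
have -> : (fun y => 'd (flow h) (s0, y) (1, 0)) = velocity h s0.
  by apply/funext => y; rewrite velocityE.
have -> : (fun s => 'd (flow (fun s => (h s)^-1%g)) (s, flow h (s, x))
    (0, Y (flow h (s, x)))) = (fun s => push (h s)^-1%g Y x).
  by apply/funext => s; rewrite /push invgK -(diff_action _ _ _ vC).
apply; rewrite /flow /=.
- by move=> y; rewrite h1 Phi1.
- by move=> y; rewrite h1 invg1 Phi1.
- by move=> s y; exact: action_invK.
Qed.

(** Factoring [h s = k s * h t] with [k t = 1], the push-forward by the inverse of [h t] is, at [x],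
    a fixed linear map applied to a quantity whose derivative is already known. *)
Lemma is_derive_push h (t : R) Y x : smooth_curve A h -> smooth_on setT Y ->
  is_derive t 1 (fun s => push (h s)^-1%g Y x)
    (push (h t)^-1%g (lie_bracket (velocity (fun s => h s * (h t)^-1)%g t) Y) x).
Proof.
move=> hC YC.
pose k s := (h s * (h t)^-1)%g.
have kC : smooth_curve A k by apply: smooth_curveM => //; exact: smooth_curve_cst.
have := is_derive_push1 (Phi (h t) x) kC (mulgV _) YC.
have -> : (fun s => push (h s)^-1%g Y x) =
    'd (Phi (h t)^-1%g) (Phi (h t) x) \o (fun s => push (k s)^-1%g Y (Phi (h t) x)).
  apply/funext => s /=.
  have -> : ((h s)^-1 = (h t)^-1 * (k s)^-1)%g by rewrite -invgM mulgVK.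
  by rewrite pushM [LHS]/push invgK.
move=> kd; rewrite {2}/push invgK; apply: is_derive_linear kd.
exact/diff_continuous/action_differentiable.
Qed.

End group_actions.

(** * Fundamental fields as velocities of curves through the identity *)

Section fundamental_fields.
Context {R : realType} {n d : nat} {G : topologicalGroupCarrierType}.
Variables (A : set (chart G 'rV[R]_d)) (Phi : G -> 'rV[R]_n -> 'rV[R]_n).
Hypotheses (hG : lie_group A) (hPhi : lie_group_action A Phi).
Notation field := ('rV[R]_n -> 'rV[R]_n).

Let fdR : finite_dimensional (R : normedModType R) := finite_dimensional_real.
Let fdd : finite_dimensional 'rV[R]_d := finite_dimensional_rV d.

Let Aatlas : smooth_atlas A. Proof. by case: hG. Qed.
Let Achart c : A c -> is_chart c. Proof. by case: Aatlas => + _ _; apply. Qed.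

(** Curves must be defined on the whole of [R]; a bound on [phi] keeps the segment inside a ball
    around [fwd c 1] contained in the codomain of the chart. *)
Lemma chart_curve c : A c -> cdom c 1%g ->
  exists2 r : R, 0 < r & forall (phi : R -> R) (xi : 'rV[R]_d),
  smooth_on setT phi -> (forall s, `|phi s *: xi| < r) ->
  smooth_curve A (fun s => bwd c (fwd c 1%g + phi s *: xi)) /\
  forall s, ccod c (fwd c 1%g + phi s *: xi).
Proof.
move=> Ac c1; have [[_ oc] cK _ _ _] := Achart Ac.
have [cy _] := cK _ c1.
have /nbhs_ballP[r /= r0 rc] := open_nbhs_nbhs (conj oc cy).
exists r => // phi xi phiC phir.
have cphi s : ccod c (fwd c 1%g + phi s *: xi).
  by apply: rc; rewrite -ball_normE /= opprD addNKr normrN.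
split=> //; apply: (smooth_map_bwd fdd Aatlas Ac _ cphi).
apply: smooth_add; first exact: smooth_cst.
by apply: smooth_scale => //; exact: smooth_cst.
Qed.

Lemma action_in_chart_differentiable c x : A c -> cdom c 1%g ->
  differentiable (fun y => Phi (bwd c y) x) (fwd c 1%g).
Proof.
move=> Ac c1; have [[_ oc] cK _ _ _] := Achart Ac.
have [cy cyK] := cK _ c1; have [[_ PhiC] _ _] := hPhi.
have Pc : prod_atlas A (std_atlas 'rV[R]_n)
    (prod_chart c (Chart [set: 'rV[R]_n] [set: 'rV[R]_n] id id)).
  by exists c, (Chart [set: 'rV[R]_n] [set: 'rV[R]_n] id id).
have [/(_ (fwd c 1%g, x)) PhiD _] := PhiC _ _ Pc erefl 1%N.
by have [] := is_diff_pairr (PhiD (conj (conj cy I) I)).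
Qed.

(** The chain rule through the chart, valid because [h] stays in [cdom c] near [s0]. As [c] is any
    chart at 1, it also allows a change of chart. *)
Lemma velocity_fundamental c (h : R -> G) s0 :
  A c -> cdom c 1%g -> smooth_curve A h -> h s0 = 1%g ->
  velocity Phi h s0 = fundamental_field Phi c ('d (fwd c \o h) s0 1).
Proof.
move=> Ac c1 [hc hC] h1; apply/funext => x.
have [[oc _] cK _ _ _] := Achart Ac.
have hd : differentiable (fwd c \o h) s0.
  have [/(_ s0) + _] := hC _ c erefl Ac 1%N.
  by apply; split=> //=; rewrite h1.
have Pd := action_in_chart_differentiable x Ac c1.
have Pd' : differentiable (fun y => Phi (bwd c y) x) ((fwd c \o h) s0).
  by rewrite /= h1.
have D := is_diff_comp (differentiableP hd) (differentiableP Pd').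
have near_h : \forall s \near s0, ((fun y => Phi (bwd c y) x) \o (fwd c \o h)) s
    = Phi (h s) x.
  have hs : nbhs s0 (h @^-1` cdom c).
    by apply: hc; rewrite h1; exact: open_nbhs_nbhs.
  by apply: filterS hs => s /cK[_ /= ->].
have [fd dE] := near_eq_is_diff near_h D.
by rewrite /velocity derive1E deriveE// dE /= h1.
Qed.

Lemma fundamental_curve c xi : A c -> cdom c 1%g ->
  exists h, [/\ smooth_curve A h, h 0 = 1%g &
    velocity Phi h 0 = fundamental_field Phi c xi].
Proof.
move=> Ac c1; have [r r0 curve] := chart_curve Ac c1.
have [_ cK cK' _ _] := Achart Ac.
(* The parameter used is [e * sin (s / e)]: its derivative at 0 is 1, and its amplitude [e] keeps
   [phi s *: xi] shorter than [r]. *)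
pose e := r / (`|xi| + 1).
have xi1 : 0 < `|xi| + 1 by rewrite ltr_wpDl.
have e0 : 0 < e by rewrite divr_gt0.
pose phi (s : R) := e * sin (e^-1 * s).
have phiC : smooth_on setT phi.
  apply: (smooth_scale (a := cst e)) => [|k]; first exact: smooth_cst.
  apply: (class_C_comp fdR openT _ _ (class_C_sin_cos k).1) => //.
  apply: class_C_scale => //; [exact: openT|exact: class_C_cst|exact: smooth_id].
have phi0 : phi 0 = 0 by rewrite /phi mulr0 sin0 mulr0.
have phi_lt s : `|phi s *: xi| < r.
  rewrite normrZ /phi normrM gtr0_norm// /e -mulrA -mulrA gtr_pMr//.
  rewrite ltr_pdivrMl// mulr1.
  rewrite (@le_lt_trans _ _ `|xi|) ?ltrDl// ler_piMl//.
  by rewrite ler_norml sin_geN1 sin_le1.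
have [hC hcc] := curve phi xi phiC phi_lt.
have h1 : bwd c (fwd c 1%g + phi 0 *: xi) = 1%g.
  by rewrite phi0 scale0r addr0 (cK _ c1).2.
eexists; split; [exact: hC|exact: h1|].
rewrite (velocity_fundamental Ac c1 hC h1); congr fundamental_field.
rewrite (_ : fwd c \o _ = fun s => fwd c 1%g + phi s *: xi); last first.
  by apply/funext => s /=; rewrite (cK' _ (hcc s)).2.
have dphi : is_derive (0 : R) 1 phi 1.
  have d1 := is_diff_is_derive (1 : R) (is_diff_scaler e^-1 0).
  have d2 := is_derive1_comp (is_derive_sin _) d1.
  apply: is_derive_eq (is_deriveZ e d2) _.
  by rewrite scaler0 cos0 -![_ *: _]/(_ * _) mul1r mulr1 divff// gt_eqF.
have lineD : is_diff (phi 0) (fun y : R => fwd c 1%g + y *: xi) ( *:%R^~ xi).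
  have := is_diffD (is_diff_cst (fwd c 1%g) (phi 0)) (is_diff_scalel (phi 0) xi).
  by rewrite add0r.
have [cd cE] := is_derive_comp1 dphi (@ex_diff _ _ _ _ _ _ _ lineD).
rewrite -deriveE; last exact/derivable1_diffP.
by rewrite cE diff_val scale1r.
Qed.

(** Trades charts for curves, on which the group operations act directly. *)
Lemma fundamental_fieldsE : fundamental_fields A Phi =
  [set X | exists h, [/\ smooth_curve A h, h 0 = 1%g & X = velocity Phi h 0]].
Proof.
apply/seteqP; split=> [_ [c [xi [Ac c1 ->]]]|_ [h [hC h1 ->]]] /=.
  by have [h [hC h1 <-]] := fundamental_curve xi Ac c1; exists h.
have [_ /(_ 1%g)[c Ac c1] _] := Aatlas.
by exists c, ('d (fwd c \o h) 0 1); split=> //; exact: velocity_fundamental.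
Qed.

Lemma fundamental_fields_velocity (h : R -> G) s0 :
  smooth_curve A h -> h s0 = 1%g ->
  fundamental_fields A Phi (velocity Phi h s0).
Proof.
move=> hC h1; have [_ /(_ 1%g)[c Ac c1] _] := Aatlas.
by exists c, ('d (fwd c \o h) s0 1); split=> //; exact: velocity_fundamental.
Qed.

Lemma fundamental_fields_findim :
  findim_space_of_fields (fundamental_fields A Phi).
Proof.
have [_ /(_ 1%g)[c Ac c1] _] := Aatlas.
exists d, (fun j => fundamental_field Phi c (delta_mx 0 j)); split=> [j|].
  have [h [hC _ <-]] := fundamental_curve (delta_mx 0 j) Ac c1.
  exact: (@smooth_velocity _ _ _ _ _ _ hG hPhi h 0 hC).
have FE xi : fundamental_field Phi c xi =
    fun x => \sum_(j < d) xi 0 j *: fundamental_field Phi c (delta_mx 0 j) x.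
  apply/funext => x; rewrite /fundamental_field {1}(row_sum_delta xi) linear_sum.
  by apply: eq_bigr => j _; rewrite linearZ.
apply/seteqP; split=> [X|_ [a ->]] /=.
  (* A fundamental field given in any chart is realised by a curve, then read back in the fixed
     chart [c], where it is linear in [xi]. *)
  rewrite fundamental_fieldsE => -[h [hC h1 ->]].
  rewrite (velocity_fundamental Ac c1 hC h1) FE.
  by exists (fun j => 'd (fwd c \o h) 0 1 0 j).
exists c, (\row_j a j); split=> //; rewrite FE; apply/funext => x.
by apply: eq_bigr => j _; rewrite mxE.
Qed.

End fundamental_fields.

(** * Stability under push-forwards and under brackets *)

Section structure_preservation.
Context {R : realType} {n d : nat} {G : topologicalGroupCarrierType}.
Variables (A : set (chart G 'rV[R]_d)) (Phi : G -> 'rV[R]_n -> 'rV[R]_n).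
Hypotheses (hG : lie_group A) (hPhi : lie_group_action A Phi).
Notation field := ('rV[R]_n -> 'rV[R]_n).
Notation W := (fundamental_fields A Phi).
Implicit Types V : set field.

Let fdR : finite_dimensional (R : normedModType R) := finite_dimensional_real.
Let fdn : finite_dimensional 'rV[R]_n := finite_dimensional_rV n.
Let fdRn : finite_dimensional (R * 'rV[R]_n)%type :=
  finite_dimensional_prod fdR fdn.

Lemma push_sum a (I : finType) (k : I -> R) (f : I -> field) :
  push Phi a (fun x => \sum_i k i *: f i x) =
  fun x => \sum_i k i *: push Phi a (f i) x.
Proof.
apply/funext => x; rewrite /push linear_sum.
by apply: eq_bigr => i _; rewrite linearZ.
Qed.

(** The bracket is the derivative at 0 of a curve of fields in [V]. The frame expansion holds along
    the curve, hence for its derivative, which is thereby a combination of frame fields. This is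
    used for [V] and for [W] alike. *)
Lemma push_stable_brackets V : findim_space_of_fields V ->
  (forall a Y, V Y -> V (push Phi a Y)) -> brackets_in W V V.
Proof.
move=> fV pV X Y; rewrite (fundamental_fieldsE hG hPhi) => -[h [hC h1 ->]] VY.
have Vlin := findim_linear_closed fV.
have [I [p [c [u [Vu uE]]]]] := evaluation_frame_exists fV.
have YC := findim_smooth fV VY.
pose Z := lie_bracket (velocity Phi h 0) Y.
have dZ y : is_derive (0 : R) 1 (fun s => push Phi (h s)^-1%g Y y) (Z y).
  exact: (is_derive_push1 hG hPhi).
rewrite -/Z; suff -> : Z = fun x => \sum_i Z (p i) 0 (c i) *: u i x.
  exact: linear_closed_sum.
apply/funext => x; apply: (is_derive_unique (dZ x)).
have -> : (fun s => push Phi (h s)^-1%g Y x) = fun s =>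
    \sum_i push Phi (h s)^-1%g Y (p i) 0 (c i) *: u i x.
  by apply/funext => s; apply: uE; exact: pV.
apply: is_derive_big => i.
have := is_diff_scale (is_derive_is_diff (is_derive_coord (c i) (dZ (p i))))
  (is_diff_cst (u i x) 0).
move=> /(is_diff_is_derive (1 : R)) /=.
by rewrite scaler0 add0r scale1r.
Qed.

Lemma push_stable_fundamental a Y : W Y -> W (push Phi a Y).
Proof.
rewrite (fundamental_fieldsE hG hPhi) => -[h [hC h1 ->]].
exists (fun s => a * h s * a^-1)%g; split.
- apply: (smooth_curveM hG); last exact: smooth_curve_cst.
  by apply: (smooth_curveM hG) => //; exact: smooth_curve_cst.
- by rewrite h1 mulg1 mulgV.
- exact: (push_velocity hG hPhi).
Qed.

(** The hypothesis is tested on a constant curve and a time-independent field, where the velocity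
    term vanishes. *)
Lemma structure_preserving_push V : findim_space_of_fields V ->
  structure_preserving A V Phi -> forall a Y, V Y -> V (push Phi a Y).
Proof.
move=> fV sV a Y VY.
have [] := sV (cst a) (fun=> Y) (smooth_curve_cst A a).
  split=> //; apply: smooth_comp => //; first exact: smooth_snd.
  exact: findim_smooth VY.
move=> _ /(_ 0); congr V; apply/funext => x.
have D := derive1_cst (Phi a (Phi a^-1%g x)) 0.
by rewrite /star_action /push -[RHS]add0r -[in RHS]D.
Qed.

(** The hypothesis is tested on the zero field, where only the velocity of the curve remains. *)
Lemma structure_preserving_fundamental V : findim_space_of_fields V ->
  structure_preserving A V Phi -> W `<=` V.
Proof.
move=> fV sV Y; rewrite (fundamental_fieldsE hG hPhi) => -[h [hC h1 ->]].
have [_ Phi1 _] := hPhi.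
have [] := sV h (fun=> cst 0) hC.
  split; first exact: smooth_cst.
  by move=> _; exact: (findim_linear_closed fV).1.
move=> _ /(_ 0); congr V; apply/funext => x.
by rewrite /star_action h1 invg1 Phi1 linear0 addr0.
Qed.

(** The velocity in question is the action of [h] on the zero field, hence smooth in [(t, x)]. This
    gives the continuity of the coefficients of the differential system below. *)
Lemma continuous_velocity_bracket (h : R -> G) (u : field) (y : 'rV[R]_n) :
  smooth_curve A h -> smooth_on setT u ->
  continuous (fun t => lie_bracket
    (velocity Phi (fun s => h s * (h t)^-1)%g t) u y : 'rV[R]_n).
Proof.
move=> hC uC.
pose Xi (p : R * 'rV[R]_n) := star_action Phi h (fun=> cst 0) p.1 p.2.
have XiC : smooth_on setT Xi.
  by apply: (smooth_star_action hG hPhi) => //; exact: smooth_cst.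
have vE t : velocity Phi (fun s => h s * (h t)^-1)%g t = fun x => Xi (t, x).
  apply/funext => x; rewrite /Xi (star_action_split hPhi) /=.
  by rewrite /push linear0 addr0.
have yC : smooth_on setT (fun t : R => (t, y)).
  by apply: smooth_pair; [exact: smooth_id|exact: smooth_cst].
have bE t : lie_bracket (velocity Phi (fun s => h s * (h t)^-1)%g t) u y =
    'd u y (Xi (t, y)) + - 'd Xi (t, y) (0, u y).
  rewrite /lie_bracket vE; congr (_ - _).
  by have [_ ->] := is_diff_pairl (smooth_differentiable (t, y) XiC).
under eq_fun do rewrite bE.
have c1 : smooth_on setT (fun t : R => 'd u y (Xi (t, y))).
  apply: (smooth_diff_apply (a := cst y) (v := fun t => Xi (t, y)) fdn _ _ uC).
    exact: smooth_cst.
  exact: smooth_comp fdRn yC XiC.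
have c2 : smooth_on setT (fun t : R => 'd Xi (t, y) (0, u y)).
  apply: (smooth_diff_apply (v := cst (0, u y)) fdRn yC _ XiC).
  exact: smooth_cst.
by move=> t; apply: cvgB; [have := c1 0%N|have := c2 0%N] => /(_ t I).
Qed.

(* For a fixed evaluation functional [f |-> f x 0 k - (its value predicted by the
   frame)], the values on the pulled back frame fields solve a homogeneous
   linear differential equation with zero initial value. *)
Lemma brackets_push_stable_curve V (h : R -> G) (T : R) Y :
  findim_space_of_fields V -> W `<=` V -> brackets_in W V V ->
  smooth_curve A h -> h 0 = 1%g -> 0 <= T -> V Y -> V (push Phi (h T)^-1%g Y).
Proof.
move=> fV WV bV hC h1 T0 VY.
have Vlin := findim_linear_closed fV.
have [I [p [c [u [Vu uE]]]]] := evaluation_frame_exists fV.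
have uC i := findim_smooth fV (Vu i).
pose B t i := lie_bracket (velocity Phi (fun s => h s * (h t)^-1)%g t) (u i).
have VB t i : V (B t i).
  apply: bV => //; apply: (fundamental_fields_velocity hG hPhi).
    by apply: (smooth_curveM hG) => //; exact: smooth_curve_cst.
  by rewrite mulgV.
pose Z s i := push Phi (h s)^-1%g (u i).
(* Since [B t i] lies in [V], these evaluations are its coefficients in the frame. *)
pose M i j t := B t i (p j) 0 (c j).
have dZ i (t : R) x : is_derive t 1 (fun s => Z s i x) (\sum_j M i j t *: Z t j x).
  apply: is_derive_eq (is_derive_push hG hPhi t x hC (uC i)) _.
  rewrite -/(B t i) (_ : B t i = fun x => \sum_j M i j t *: u j x).
    by rewrite push_sum.
  by apply/funext => y; exact: uE.
have ZE s i x : 0 <= s -> Z s i x = \sum_j Z s i (p j) 0 (c j) *: u j x.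
  move=> s0; apply/rowP => k; rewrite summxE.
  pose w i s := Z s i x 0 k - \sum_j u j x 0 k *: Z s i (p j) 0 (c j).
  have dw i' (t : R) : is_derive t 1 (w i') (\sum_j M i' j t * w j t).
    have dZk := is_derive_coord k (dZ i' t x).
    have dZp j := is_deriveZ (u j x 0 k) (is_derive_coord (c j) (dZ i' t (p j))).
    apply: is_derive_eq (is_deriveB dZk (is_derive_big (index_enum I) dZp)) _.
    rewrite summxE; under eq_bigr do rewrite mxE.
    under [X in _ - X]eq_bigr do rewrite summxE scaler_sumr.
    (* After exchanging the sums, the defects [w] satisfy the same system as the [Z]. *)
    rewrite [X in _ - X]exchange_big -sumrB; apply: eq_bigr => j _.
    rewrite /w mulrBr mulr_sumr; congr (_ - _); apply: eq_bigr => j' _.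
    by rewrite mxE -![_ *: _]/(_ * _) mulrCA.
  have Mc i' j' : continuous (M i' j').
    move=> t; apply: (@continuous_comp _ _ _ (fun t => B t i' (p j'))
      (fun v : 'rV[R]_n => v 0 (c j'))); last exact: coord_continuous.
    exact: continuous_velocity_bracket.
  have w0 i' : w i' 0 = 0.
    have Z0 y : Z 0 i' y = u i' y by rewrite /Z h1 invg1 (push1 hPhi).
    rewrite /w Z0; apply/eqP; rewrite subr_eq0 [u i' x]uE//; apply/eqP.
    by rewrite summxE; apply: eq_bigr => j _; rewrite Z0 mxE mulrC.
  have := linear_ode_zero dw Mc w0 s0 i.
  move/eqP; rewrite subr_eq0 => /eqP->; apply: eq_bigr => j _.
  by rewrite mxE mulrC.
have -> : Y = fun x => \sum_i Y (p i) 0 (c i) *: u i x.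
  by apply/funext => x; exact: uE.
rewrite push_sum; apply: linear_closed_sum => // i.
rewrite (_ : push _ _ _ = fun x => \sum_j Z T i (p j) 0 (c j) *: u j x).
  exact: linear_closed_sum.
by apply/funext => x; exact: ZE.
Qed.

(** Left translations make [H] open. It is also closed: if [a] is outside [H], every [b] near [a]
    has [b^-1 * a] in [H], so [b] in [H] would force [a = b * (b^-1 * a)] into [H]. *)
Lemma connected_group_nbhs1 (H : set G) : connected [set: G] ->
  nbhs 1%g H -> (forall a b, H a -> H b -> H (a * b)%g) -> H = setT.
Proof.
move=> Gconn H1 HM.
have [_ _ [mulc _] [invc _]] := hG.
have mulC (f g : G -> G) a : {for a, continuous f} -> {for a, continuous g} ->
    {for a, continuous (fun b => f b * g b)%g}.
  move=> fc gc; apply: (@continuous_comp _ _ _ (fun b => (f b, g b))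
    (fun p : G * G => (p.1 * p.2)%g)); last exact: mulc.
  exact: cvg_pair.
have Hopen : open H.
  rewrite openE => a Ha; rewrite /interior.
  have lc : {for a, continuous (fun b => a^-1 * b)%g}.
    by apply: mulC; [exact: cvg_cst|exact: cvg_id].
  have : nbhs a ((fun b => a^-1 * b)%g @^-1` H) by apply: lc; rewrite mulVg.
  by apply: filterS => b /(HM _ _ Ha); rewrite mulVKg.
have Hclosed : closed H.
  rewrite -(setCK H) closedC openE => a nHa; rewrite /interior.
  have rc : {for a, continuous (fun b => b^-1 * a)%g}.
    by apply: mulC; [exact: invc|exact: cvg_cst].
  have : nbhs a ((fun b => b^-1 * a)%g @^-1` H) by apply: rc; rewrite mulVg.
  by apply: filterS => b Hba Hb; apply: nHa; have := HM _ _ Hb Hba; rewrite mulVKg.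
apply: Gconn.
- by exists 1%g; exact: nbhs_singleton.
- by exists H; rewrite ?setTI.
- by exists H; rewrite ?setTI.
Qed.

Lemma brackets_push_stable V : connected [set: G] ->
  findim_space_of_fields V -> W `<=` V -> brackets_in W V V ->
  forall a Y, V Y -> V (push Phi a Y).
Proof.
move=> Gconn fV WV bV a Y.
(* The inverse matches the stability result along curves; the condition is multiplicative because
   inversion only reverses the order of the push-forwards. *)
pose H : set G := [set b | forall Y, V Y -> V (push Phi b^-1%g Y)].
have HT : H = setT.
  apply: connected_group_nbhs1 => //; last first.
    by move=> b b' Hb Hb' Z VZ; rewrite invgM (pushM hG hPhi); apply/Hb'/Hb.
  have [Achart Acov _] : smooth_atlas A by case: hG.
  have [c Ac c1] := Acov 1%g; have [[oc _] cK _ _ _] := Achart _ Ac.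
  have [r r0 curve] := chart_curve hG Ac c1.
  have near1 : nbhs (1%g : G) (cdom c `&` fwd c @^-1` ball (fwd c 1%g) r).
    apply: filterI; first exact: open_nbhs_nbhs.
    exact: (is_chart_fwd (Achart _ Ac) c1) (nbhsx_ballx _ _ r0).
  apply: filterS near1 => b [cb]; rewrite /= -ball_normE /= distrC => br Z VZ.
  (* This curve follows the chart segment from 1 and reaches [b] at time [pi / 2], where the sine is
     1. *)
  have [|hC _] := curve sin (fwd c b - fwd c 1%g) (fun k => (class_C_sin_cos k).1).
    move=> s; rewrite normrZ (le_lt_trans _ br)// ler_piMl//.
    by rewrite ler_norml sin_geN1 sin_le1.
  have pi20 : 0 <= pi / 2 :> R by rewrite divr_ge0// pi_ge0.
  have := brackets_push_stable_curve fV WV bV hC _ pi20 VZ.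
  rewrite sin0 scale0r addr0 (cK _ c1).2 => /(_ erefl).
  by rewrite sin_pihalf scale1r addrC subrK (cK _ cb).2.
have : H a^-1%g by rewrite HT.
by rewrite /H /= invgK; exact.
Qed.

End structure_preservation.

Theorem mainTheorem1 (R : realType) (n d : nat)
    (G : topologicalGroupCarrierType) (A : set (chart G 'rV[R]_d))
    (V : set ('rV[R]_n -> 'rV[R]_n)) (Phi : G -> 'rV[R]_n -> 'rV[R]_n)
    (hV : findim_space_of_fields V)
    (hG : lie_group A) (hGconn : connected [set: G])
    (hPhi : lie_group_action A Phi) :
  structure_preserving A V Phi <->
  quasi_lie_scheme (fundamental_fields A Phi) V.
Proof.
have fW := fundamental_fields_findim hG hPhi.
split=> [sV|[_ _ WV bV] g X gC [XC VX]].
  split=> //.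
  (* Here the bracket lemma is applied to [W] itself, which is finite-dimensional and stable by
     conjugation. *)
  - exact: push_stable_brackets (push_stable_fundamental hG hPhi).
  - exact: structure_preserving_fundamental.
  - exact: push_stable_brackets (structure_preserving_push hV sV).
split=> [|t]; first exact: (smooth_star_action hG hPhi).
rewrite (star_action_split hPhi).
apply: linear_closed_add; first exact: findim_linear_closed.
  apply: WV; apply: (fundamental_fields_velocity hG hPhi).
    by apply: (smooth_curveM hG) => //; exact: smooth_curve_cst.
  by rewrite mulgV.
exact: (brackets_push_stable hG hPhi).
Qed.
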